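(* Let $X_1$ and $X_2$ be simplicial sets. The external smash product functor $$\wedge_e\colon\mathcal R_f(X_1)\times\mathcal R_f(X_2)\longrightarrow\mathcal R_f(X_1\times X_2)$$ is biexact: for each fixed value of one variable, the resulting functor in the other variable preserves cofibrations, pushouts along cofibrations, and weak equivalences.
   Context: For a simplicial set $X$, $\mathcal R(X)$ is the category of retractive simplicial sets $(Y,r\colon Y\to X,s\colon X\to Y)$ with $rs=\mathrm{id}_X$, and $\mathcal R_f(X)$ is the full subcategory of those with only finitely many nondegenerate simplices in $Y-X$. A cofibration is an injective morphism; a weak equivalence is a morphism whose geometric realization is a homotopy equivalence. For $(Y_i,r_i,s_i)\in\mathcal R(X_i)$, the exterior smash product $Y_1\wedge_eY_2\in\mathcal R(X_1\times X_2)$ is the pushout of $$X_1\times X_2\xleftarrow{\ r_1\times r_2\ }Y_1\times X_2\cup_{X_1\times X_2}X_1\times Y_2\rightarrowtail Y_1\times Y_2,$$ with the evident section and the retraction given by the universal property. *)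

(* Defs.v *)
From HB Require Import structures.
From Stdlib Require Import Relation_Operators.
From mathcomp Require Import all_boot all_order all_algebra.
From mathcomp Require Import zify.
From mathcomp Require Import all_classical all_reals topology normedtype.
Import Order.TTheory GRing.Theory Num.Theory numFieldNormedType.Exports.

Set Implicit Arguments.
Unset Strict Implicit.
Unset Printing Implicit Defensive.

Local Open Scope classical_set_scope.
Local Open Scope quotient_scope.

(** * Categories *)

Record category := Category {
  ob :> Type;
  hom : ob -> ob -> Type;
  idm : forall a, hom a a;
  comp : forall a b c, hom b c -> hom a b -> hom a c;
  comp_idl : forall a b (f : hom a b), comp (idm b) f = f;
  comp_idr : forall a b (f : hom a b), comp f (idm a) = f;
  compA : forall a b c d (h : hom c d) (g : hom b c) (f : hom a b),
    comp h (comp g f) = comp (comp h g) f }.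

Record functor (C D : category) := Functor {
  fob :> C -> D;
  fmap : forall a b, hom a b -> hom (fob a) (fob b);
  fmap_id : forall a, fmap (idm a) = idm (fob a);
  fmap_comp : forall a b c (g : hom b c) (f : hom a b),
    fmap (comp g f) = comp (fmap g) (fmap f) }.

Program Definition full_subcat (C : category) (P : C -> Prop) : category :=
  @Category {a : C | P a} (fun a b => hom (sval a) (sval b))
    (fun a => idm (sval a)) (fun _ _ _ g f => comp g f) _ _ _.
Next Obligation. by move=> *; exact: comp_idl. Qed.
Next Obligation. by move=> *; exact: comp_idr. Qed.
Next Obligation. by move=> *; exact: compA. Qed.

Program Definition prod_cat (C D : category) : category :=
  @Category (C * D)%type (fun a b => (hom a.1 b.1 * hom a.2 b.2)%type)
    (fun a => (idm a.1, idm a.2))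
    (fun _ _ _ g f => (comp g.1 f.1, comp g.2 f.2)) _ _ _.
Next Obligation. by move=> C D a b [f g] /=; rewrite !comp_idl. Qed.
Next Obligation. by move=> C D a b [f g] /=; rewrite !comp_idr. Qed.
Next Obligation. by move=> *; rewrite /= !compA. Qed.

Program Definition fix_right (C D E : category)
    (F : functor (prod_cat C D) E) (d : D) : functor C E :=
  @Functor C E (fun c => F (c, d))
    (fun a b f => fmap F (a := (a, d)) (b := (b, d)) (f, idm d)) _ _.
Next Obligation. by move=> C D E F d a; exact: (fmap_id F (a, d)). Qed.
Next Obligation.
move=> C D E F d a b c g f; rewrite -fmap_comp /=.
by rewrite comp_idl.
Qed.

Program Definition fix_left (C D E : category)
    (F : functor (prod_cat C D) E) (c : C) : functor D E :=
  @Functor D E (fun d => F (c, d))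
    (fun a b f => fmap F (a := (c, a)) (b := (c, b)) (idm c, f)) _ _.
Next Obligation. by move=> C D E F c a; exact: (fmap_id F (c, a)). Qed.
Next Obligation.
move=> C D E F c a b d g f; rewrite -fmap_comp /=.
by rewrite comp_idl.
Qed.

Definition is_pushout (C : category) (a b c d : C) (f : hom a b) (g : hom a c)
    (h : hom b d) (k : hom c d) : Prop :=
  comp h f = comp k g /\
  forall (t : C) (u : hom b t) (v : hom c t), comp u f = comp v g ->
    exists! w : hom d t, comp w h = u /\ comp w k = v.

Record cofweCategory := CofweCategory {
  cat_of :> category;
  cofibration : forall a b : cat_of, hom a b -> Prop;
  weak_equivalence : forall a b : cat_of, hom a b -> Prop }.

Definition exact_functor (C D : cofweCategory) (F : functor C D) : Prop :=
  [/\ forall (a b : C) (f : hom a b), cofibration f -> cofibration (fmap F f),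
      forall (a b c d : C) (f : hom a b) (g : hom a c) (h : hom b d)
        (k : hom c d), cofibration f -> is_pushout f g h k ->
        is_pushout (fmap F f) (fmap F g) (fmap F h) (fmap F k)
    & forall (a b : C) (f : hom a b),
        weak_equivalence f -> weak_equivalence (fmap F f)].

Definition biexact (C D E : cofweCategory) (F : functor (prod_cat C D) E) :=
  (forall d : D, exact_functor (fix_right F d)) /\ (forall c : C, exact_functor (fix_left F c)).

(** * Quotient by the equivalence relation generated by a relation *)

Section Quot.
Variables (T : choiceType) (r : T -> T -> Prop).

Definition gen_eqv : rel T := fun x y => `[< clos_refl_sym_trans T r x y >].

Lemma gen_eqv_equiv : equiv_class_of gen_eqv.
Proof.
split=> [x|x y|y x z].
- by apply/asboolP; exact: rst_refl.
- by apply/asboolP/asboolP; exact: rst_sym.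
- by move=> /asboolP xy /asboolP yz; apply/asboolP; exact: rst_trans xy yz.
Qed.

Canonical gen_eqv_equiv_rel := EquivRelPack gen_eqv_equiv.

Definition quot := {eq_quot gen_eqv}.

Definition quot_lift (U : Type) (g : T -> U) : quot -> U := g \o repr.

Lemma quot_rel x y : r x y -> \pi_quot x = \pi_quot y.
Proof. by move=> rxy; apply/eqmodP/asboolP; exact: rst_step. Qed.

Lemma quot_liftE (U : Type) (g : T -> U) :
  (forall x y, r x y -> g x = g y) -> forall x, quot_lift g (\pi_quot x) = g x.
Proof.
move=> gr x; rewrite /quot_lift /=.
have /eqmodP/asboolP : repr (\pi_quot x) = x %[mod quot] by rewrite reprK.
move: (repr _) => y; elim=> [a b /gr|//|a b _ ->|a b c _ -> _ ->] //.
Qed.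

Lemma quotP (P : quot -> Prop) : (forall x, P (\pi_quot x)) -> forall q, P q.
Proof. by move=> h q; rewrite -[q]reprK. Qed.
End Quot.

(** * The simplex category; [dhom m n] is the set of monotone maps [m] -> [n] *)

Definition dhom (m n : nat) : Type :=
  {f : {ffun 'I_m.+1 -> 'I_n.+1} |
    [forall i : 'I_m.+1, forall j : 'I_m.+1, (i <= j)%N ==> (f i <= f j)%N]}.

Definition dfun m n (f : dhom m n) : 'I_m.+1 -> 'I_n.+1 := val f.
Coercion dfun : dhom >-> Funclass.

Lemma dhomP m n (f : dhom m n) (i j : 'I_m.+1) : (i <= j)%N -> (f i <= f j)%N.
Proof.
by move=> ij; have /forallP/(_ i)/forallP/(_ j)/implyP := valP f; exact.
Qed.

Lemma dhom_ext m n (f g : dhom m n) : f =1 g -> f = g.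
Proof. by move=> fg; apply/val_inj/ffunP. Qed.

Lemma mk_dhom_subproof m n (f : 'I_m.+1 -> 'I_n.+1) :
  (forall i j : 'I_m.+1, (i <= j)%N -> (f i <= f j)%N) ->
  [forall i : 'I_m.+1, forall j : 'I_m.+1, (i <= j)%N ==>
    ([ffun k => f k] i <= [ffun k => f k] j)%N].
Proof.
move=> fm; apply/forallP => i; apply/forallP => j; apply/implyP => ij.
by rewrite !ffunE; exact: fm.
Qed.

Definition mk_dhom m n (f : 'I_m.+1 -> 'I_n.+1)
    (fm : forall i j : 'I_m.+1, (i <= j)%N -> (f i <= f j)%N) : dhom m n :=
  exist _ [ffun k => f k] (mk_dhom_subproof fm).

Lemma mk_dhomE m n f fm i : @mk_dhom m n f fm i = f i.
Proof. by rewrite /dfun /= ffunE. Qed.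

Definition did n : dhom n n := @mk_dhom n n id (fun _ _ => id).

Lemma dcomp_subproof m n p (g : dhom n p) (f : dhom m n) (i j : 'I_m.+1) :
  (i <= j)%N -> (g (f i) <= g (f j))%N.
Proof. by move=> ij; apply: dhomP; exact: dhomP. Qed.

Definition dcomp m n p (g : dhom n p) (f : dhom m n) : dhom m p :=
  mk_dhom (dcomp_subproof g f).

Lemma degen_subproof n (i : 'I_n.+1) (j : 'I_n.+2) : (unbump i j < n.+1)%N.
Proof.
by rewrite /unbump; case: ltnP => ij; have := ltn_ord i; have := ltn_ord j; lia.
Qed.

Lemma degen_mono n (i : 'I_n.+1) (j k : 'I_n.+2) :
  (j <= k)%N -> (unbump i j <= unbump i k)%N.
Proof. by rewrite /unbump; lia. Qed.

(* The codegeneracy [n+1] -> [n] hitting [i] twice. *)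
Definition codegen n (i : 'I_n.+1) : dhom n.+1 n :=
  @mk_dhom n.+1 n (fun j => Ordinal (degen_subproof i j)) (@degen_mono n i).

(** * Simplicial sets *)

Record sset := SSet {
  simp :> nat -> Type;
  act : forall m n, dhom m n -> simp n -> simp m;
  act_id : forall n (x : simp n), act (did n) x = x;
  act_comp : forall m n p (g : dhom n p) (f : dhom m n) (x : simp p),
    act (dcomp g f) x = act f (act g x) }.
Arguments act {s m n} f x.

Record smap (X Y : sset) := SMap {
  sfun :> forall n, X n -> Y n;
  sfun_act : forall m n (f : dhom m n) (x : X n),
    sfun (act f x) = act f (sfun x) }.
Arguments sfun {X Y} s {n} x.

Lemma smap_ext X Y (f g : smap X Y) : (forall n (x : X n), f n x = g n x) ->
  f = g.
Proof.
case: f g => f fn [g gn] /= fg.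
have e : f = g by apply: functional_extensionality_dep => n; apply/funext/fg.
by subst g; congr SMap; exact: Prop_irrelevance.
Qed.

Program Definition sid X : smap X X := @SMap X X (fun _ x => x) _.
Next Obligation. by []. Qed.

Program Definition scomp X Y Z (g : smap Y Z) (f : smap X Y) : smap X Z :=
  @SMap X Z (fun _ x => g _ (f _ x)) _.
Next Obligation. by move=> *; rewrite /= !sfun_act. Qed.

Program Definition sprod (X Y : sset) : sset :=
  @SSet (fun n => X n * Y n)%type (fun _ _ f x => (act f x.1, act f x.2)) _ _.
Next Obligation. by move=> X Y n [x y] /=; rewrite !act_id. Qed.
Next Obligation. by move=> *; rewrite /= !act_comp. Qed.

Program Definition sprod_map X X' Y Y' (f : smap X X') (g : smap Y Y') :
    smap (sprod X Y) (sprod X' Y') :=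
  @SMap (sprod X Y) (sprod X' Y') (fun _ x => (f _ x.1, g _ x.2)) _.
Next Obligation. by move=> *; rewrite /= !sfun_act. Qed.

(** Pushouts of simplicial sets *)
Section Pushout.
Variables (A B C : sset) (f : smap A B) (g : smap A C).

Variant po_rel n : {classic (B n + C n)%type} -> {classic (B n + C n)%type} ->
    Prop :=
  PoRel (a : A n) : po_rel (inl (f n a)) (inr (g n a)).

Definition po_simp n : Type := quot (@po_rel n).

Definition po_inl n (b : B n) : po_simp n :=
  \pi_(quot (@po_rel n)) (inl b : {classic (B n + C n)%type}).
Definition po_inr n (c : C n) : po_simp n :=
  \pi_(quot (@po_rel n)) (inr c : {classic (B n + C n)%type}).

Lemma po_glue n (a : A n) : po_inl (f n a) = po_inr (g n a).
Proof. exact/quot_rel/PoRel. Qed.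

Lemma po_ind n (P : po_simp n -> Prop) : (forall b, P (po_inl b)) ->
  (forall c, P (po_inr c)) -> forall x, P x.
Proof. by move=> Pb Pc; apply: quotP => -[b|c]; [exact: Pb|exact: Pc]. Qed.

Definition po_elim n (U : Type) (u : B n -> U) (v : C n -> U) : po_simp n -> U :=
  @quot_lift _ (@po_rel n) U
    (fun x => match x with inl b => u b | inr c => v c end).

Section Elim.
Variables (n : nat) (U : Type) (u : B n -> U) (v : C n -> U).
Hypothesis uv : forall a : A n, u (f n a) = v (g n a).
Lemma po_elim_inl b : po_elim u v (po_inl b) = u b.
Proof. by rewrite /po_elim quot_liftE // => _ _ [a]; exact: uv. Qed.
Lemma po_elim_inr c : po_elim u v (po_inr c) = v c.
Proof. by rewrite /po_elim quot_liftE // => _ _ [a]; exact: uv. Qed.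
End Elim.

Definition po_act m n (h : dhom m n) : po_simp n -> po_simp m :=
  po_elim (fun b => po_inl (act h b)) (fun c => po_inr (act h c)).

Lemma po_act_inl m n (h : dhom m n) b : po_act h (po_inl b) = po_inl (act h b).
Proof. by apply: po_elim_inl => a; rewrite -!sfun_act po_glue. Qed.
Lemma po_act_inr m n (h : dhom m n) c : po_act h (po_inr c) = po_inr (act h c).
Proof. by apply: po_elim_inr => a; rewrite -!sfun_act po_glue. Qed.

Program Definition spush : sset := @SSet po_simp po_act _ _.
Next Obligation.
by move=> n; apply: po_ind => b; rewrite ?po_act_inl ?po_act_inr act_id.
Qed.
Next Obligation.
move=> m n p h k; apply: po_ind => b;
  by rewrite ?po_act_inl ?po_act_inr act_comp.
Qed.

Program Definition spush_inl : smap B spush := @SMap B spush po_inl _.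
Next Obligation. by move=> *; rewrite /= po_act_inl. Qed.
Program Definition spush_inr : smap C spush := @SMap C spush po_inr _.
Next Obligation. by move=> *; rewrite /= po_act_inr. Qed.

Program Definition spush_lift (D : sset) (u : smap B D) (v : smap C D)
    (uv : forall n (a : A n), u n (f n a) = v n (g n a)) : smap spush D :=
  @SMap spush D (fun n => po_elim (u n) (v n)) _.
Next Obligation.
move=> D u v uv m n h; apply: po_ind => b /=.
  by rewrite po_act_inl !po_elim_inl // sfun_act.
by rewrite po_act_inr !po_elim_inr // sfun_act.
Qed.

Lemma spush_lift_inl D u v uv n b :
  @spush_lift D u v uv n (spush_inl n b) = u n b.
Proof. exact: po_elim_inl. Qed.
Lemma spush_lift_inr D u v uv n c :
  @spush_lift D u v uv n (spush_inr n c) = v n c.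
Proof. exact: po_elim_inr. Qed.
Lemma spush_glue n (a : A n) : spush_inl n (f n a) = spush_inr n (g n a).
Proof. exact: po_glue. Qed.
Lemma spush_ind n (P : spush n -> Prop) : (forall b, P (spush_inl n b)) ->
  (forall c, P (spush_inr n c)) -> forall x, P x.
Proof. exact: po_ind. Qed.
End Pushout.

Inductive degenerate (X : sset) : forall n, X n -> Prop :=
  Degenerate n (i : 'I_n.+1) (z : X n) : degenerate (act (codegen i) z).

(** * Geometric realization *)

Section Realization.
Local Open Scope ring_scope.
Variable R : realType.

Definition std_simplex n : set 'rV[R]_n.+1 :=
  [set t | (forall i, 0 <= t ord0 i) /\ \sum_i t ord0 i = 1].
Arguments std_simplex : clear implicits.

Lemma simplex_map_subproof m n (f : dhom m n) (t : std_simplex m) :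
  (\row_j \sum_(i | f i == j) set_val t ord0 i) \in std_simplex n.
Proof.
have /set_mem[t0 t1] := valP t; apply/mem_set; split.
  by move=> j; rewrite mxE; apply: sumr_ge0 => i _; exact: t0.
rewrite -t1 (partition_big f xpredT) //=.
by apply: eq_bigr => j _; rewrite mxE.
Qed.

(* The affine map sending the vertex [i] to the vertex [f i]. *)
Definition simplex_map m n (f : dhom m n) (t : std_simplex m) : std_simplex n :=
  SigSub (simplex_map_subproof f t).

(* The disjoint union, over all simplices [x] of [X], of a copy of the standard
   simplex of dimension [dim x]. *)
Definition cells (X : sset) :=
  {x : {classic {n & X n}} & set_type (std_simplex (projT1 x))}.
HB.instance Definition _ X := Topological.on (cells X).

Definition cell (X : sset) n (x : X n) (t : std_simplex n) : cells X :=
  existT (fun x : {classic {n & X n}} => set_type (std_simplex (projT1 x)))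
    (existT _ n x) t.

Variant cell_rel (X : sset) : cells X -> cells X -> Prop :=
  CellRel m n (f : dhom m n) (x : X n) (t : std_simplex m) :
    cell_rel (cell (act f x) t) (cell x (simplex_map f t)).

Definition realization (X : sset) := quotient_topology (quot (@cell_rel X)).
HB.instance Definition _ X := Topological.on (realization X).

Definition real_pt (X : sset) n (x : X n) (t : std_simplex n) : realization X :=
  \pi_(quot (@cell_rel X)) (cell x t).

Definition realization_map (X Y : sset) (f : smap X Y) :
    realization X -> realization Y :=
  @quot_lift _ (@cell_rel X) _
    (fun c => real_pt (f _ (projT2 (projT1 c))) (projT2 c)).

Lemma realization_mapE (X Y : sset) (f : smap X Y) n (x : X n) t :
  realization_map f (real_pt x t) = real_pt (f n x) t.
Proof.
rewrite /realization_map quot_liftE // => _ _ [m p g y u] /=.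
by rewrite sfun_act; apply/quot_rel/CellRel.
Qed.

Definition homotopic (A B : topologicalType) (f g : A -> B) : Prop :=
  exists H : A * R -> B,
    [/\ {within setT `*` `[0, 1], continuous H},
        forall a, H (a, 0) = f a & forall a, H (a, 1) = g a].

Definition homotopy_equivalence (A B : topologicalType) (f : A -> B) : Prop :=
  continuous f /\
  exists g : B -> A,
    [/\ continuous g, homotopic (g \o f) idfun & homotopic (f \o g) idfun].

Definition weak_eqv (X Y : sset) (f : smap X Y) : Prop :=
  homotopy_equivalence (realization_map f).
End Realization.
Arguments std_simplex : clear implicits.

Definition sinjective (X Y : sset) (f : smap X Y) : Prop :=
  forall n, injective (f n).

(** * Retractive simplicial sets *)

Record retractive (X : sset) := Retractive {
  tot :> sset;
  retr : smap tot X;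
  sect : smap X tot;
  sectK : forall n (x : X n), retr n (sect n x) = x }.
Arguments retr {X} r.
Arguments sect {X} r.

Record rmap (X : sset) (Y Z : retractive X) := RMap {
  rfun :> smap Y Z;
  rfun_retr : forall n (y : Y n), retr Z n (rfun n y) = retr Y n y;
  rfun_sect : forall n (x : X n), rfun n (sect Y n x) = sect Z n x }.

Lemma rmap_ext X (Y Z : retractive X) (f g : rmap Y Z) :
  (forall n (y : Y n), f n y = g n y) -> f = g.
Proof.
case: f g => f f1 f2 [g g1 g2] /= /smap_ext fg.
by subst g; congr RMap; exact: Prop_irrelevance.
Qed.

Definition rid X (Y : retractive X) : rmap Y Y :=
  @RMap X Y Y (sid Y) (fun _ _ => erefl) (fun _ _ => erefl).

Program Definition rcomp X (Y Z W : retractive X) (g : rmap Z W) (f : rmap Y Z) :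
    rmap Y W := @RMap X Y W (scomp g f) _ _.
Next Obligation. by move=> *; rewrite /= !rfun_retr. Qed.
Next Obligation. by move=> *; rewrite /= !rfun_sect. Qed.

Program Definition retr_cat (X : sset) : category :=
  @Category (retractive X) (@rmap X) (@rid X) (@rcomp X) _ _ _.
Next Obligation. by move=> *; exact: rmap_ext. Qed.
Next Obligation. by move=> *; exact: rmap_ext. Qed.
Next Obligation. by move=> *; exact: rmap_ext. Qed.

Definition new_simplices (X : sset) (Y : retractive X) : set {n & Y n} :=
  [set y | ~ degenerate (projT2 y) /\
           ~ exists x : X (projT1 y), sect Y _ x = projT2 y].
Arguments new_simplices {X} Y.

Definition finite_retractive (X : sset) (Y : retractive X) : Prop :=
  finite_set (new_simplices Y).

Definition Rf_cat (X : sset) : category :=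
  @full_subcat (retr_cat X) (@finite_retractive X).

Definition Rf (R : realType) (X : sset) : cofweCategory :=
  @CofweCategory (Rf_cat X) (fun Y Z (f : rmap (sval Y) (sval Z)) => sinjective f)
    (fun Y Z (f : rmap (sval Y) (sval Z)) => weak_eqv R f).

(** * The exterior smash product *)

Section Smash.
Variables X1 X2 : sset.

Section Objects.
Variables (Y1 : retractive X1) (Y2 : retractive X2).

Definition fat_wedge : sset :=
  spush (sprod_map (sect Y1) (sid X2)) (sprod_map (sid X1) (sect Y2)).

Definition fat_inl : smap (sprod Y1 X2) fat_wedge :=
  spush_inl (sprod_map (sect Y1) (sid X2)) (sprod_map (sid X1) (sect Y2)).
Definition fat_inr : smap (sprod X1 Y2) fat_wedge :=
  spush_inr (sprod_map (sect Y1) (sid X2)) (sprod_map (sid X1) (sect Y2)).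

Program Definition fat_wedge_incl : smap fat_wedge (sprod Y1 Y2) :=
  @spush_lift _ _ _ _ _ (sprod Y1 Y2)
    (sprod_map (sid Y1) (sect Y2)) (sprod_map (sect Y1) (sid Y2)) _.
Next Obligation. by []. Qed.

Program Definition fat_wedge_retr : smap fat_wedge (sprod X1 X2) :=
  @spush_lift _ _ _ _ _ (sprod X1 X2)
    (sprod_map (retr Y1) (sid X2)) (sprod_map (sid X1) (retr Y2)) _.
Next Obligation. by move=> n [x1 x2] /=; rewrite !sectK. Qed.

Lemma fat_wedge_ind n (P : fat_wedge n -> Prop) :
  (forall (y : Y1 n) (x : X2 n), P (fat_inl n (y, x))) ->
  (forall (x : X1 n) (y : Y2 n), P (fat_inr n (x, y))) -> forall a, P a.
Proof. by move=> h k; apply: spush_ind => -[]. Qed.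

Definition smash_tot : sset := spush fat_wedge_incl fat_wedge_retr.

Program Definition smash : retractive (sprod X1 X2) :=
  @Retractive (sprod X1 X2) smash_tot
    (@spush_lift _ _ _ _ _ (sprod X1 X2)
      (sprod_map (retr Y1) (retr Y2)) (sid (sprod X1 X2)) _)
    (spush_inr fat_wedge_incl fat_wedge_retr) _.
Next Obligation.
move=> n; apply: fat_wedge_ind => [y x|x y];
  by rewrite ?spush_lift_inl ?spush_lift_inr /= sectK.
Qed.
Next Obligation. by move=> n x; rewrite spush_lift_inr. Qed.

Definition smash_pair n (y1 : Y1 n) (y2 : Y2 n) : smash n :=
  spush_inl fat_wedge_incl fat_wedge_retr n (y1, y2).

Lemma smash_sectl n (x1 : X1 n) (y2 : Y2 n) :
  smash_pair (sect Y1 n x1) y2 = sect smash n (x1, retr Y2 n y2).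
Proof.
have := spush_glue fat_wedge_incl fat_wedge_retr
  (fat_inr n (x1, y2)).
by rewrite !spush_lift_inr.
Qed.

Lemma smash_sectr n (y1 : Y1 n) (x2 : X2 n) :
  smash_pair y1 (sect Y2 n x2) = sect smash n (retr Y1 n y1, x2).
Proof.
have := spush_glue fat_wedge_incl fat_wedge_retr
  (fat_inl n (y1, x2)).
by rewrite !spush_lift_inl.
Qed.

Lemma smash_ind n (P : smash n -> Prop) :
  (forall y1 y2, P (smash_pair y1 y2)) -> (forall x, P (sect smash n x)) ->
  forall z, P z.
Proof. by move=> h k; apply: spush_ind => [[y1 y2]|x]; [exact: h|exact: k]. Qed.

Lemma smash_pair_act m n (f : dhom m n) (y1 : Y1 n) (y2 : Y2 n) :
  smash_pair (act f y1) (act f y2) = act f (smash_pair y1 y2).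
Proof. by rewrite /smash_pair -sfun_act. Qed.
End Objects.

Section Maps.
Variables (Y1 Z1 : retractive X1) (Y2 Z2 : retractive X2).
Variables (f1 : rmap Y1 Z1) (f2 : rmap Y2 Z2).

Program Definition smash_smap : smap (smash Y1 Y2) (smash Z1 Z2) :=
  @spush_lift _ _ _ _ _ (smash Z1 Z2)
    (scomp (spush_inl (fat_wedge_incl Z1 Z2) (fat_wedge_retr Z1 Z2))
      (sprod_map f1 f2))
    (sect (smash Z1 Z2)) _.
Next Obligation.
move=> n; apply: fat_wedge_ind => [y x|x y].
- rewrite !spush_lift_inl /=.
  by rewrite rfun_sect -(rfun_retr f1); exact: smash_sectr.
- rewrite !spush_lift_inr /=.
  by rewrite rfun_sect -(rfun_retr f2); exact: smash_sectl.
Qed.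

Lemma smash_smap_pair n (y1 : Y1 n) (y2 : Y2 n) :
  smash_smap n (smash_pair y1 y2) = smash_pair (f1 n y1) (f2 n y2).
Proof. exact: spush_lift_inl. Qed.

Lemma smash_smap_sect n (x : sprod X1 X2 n) :
  smash_smap n (sect (smash Y1 Y2) n x) = sect (smash Z1 Z2) n x.
Proof. exact: spush_lift_inr. Qed.

Lemma smash_smap_retr n (z : smash Y1 Y2 n) :
  retr (smash Z1 Z2) n (smash_smap n z) = retr (smash Y1 Y2) n z.
Proof.
elim/smash_ind: z => [y1 y2|x].
  by rewrite smash_smap_pair !spush_lift_inl /= !rfun_retr.
by rewrite smash_smap_sect !sectK.
Qed.

Definition smash_map : rmap (smash Y1 Y2) (smash Z1 Z2) :=
  RMap smash_smap_retr smash_smap_sect.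
End Maps.

Lemma smash_map_id (Y1 : retractive X1) (Y2 : retractive X2) :
  smash_map (rid Y1) (rid Y2) = rid (smash Y1 Y2).
Proof.
apply: rmap_ext => n; apply: smash_ind => [y1 y2|x].
  exact: smash_smap_pair.
exact: smash_smap_sect.
Qed.

Lemma smash_map_comp (Y1 Z1 W1 : retractive X1) (Y2 Z2 W2 : retractive X2)
    (g1 : rmap Z1 W1) (g2 : rmap Z2 W2) (f1 : rmap Y1 Z1) (f2 : rmap Y2 Z2) :
  smash_map (rcomp g1 f1) (rcomp g2 f2) =
  rcomp (smash_map g1 g2) (smash_map f1 f2).
Proof.
apply: rmap_ext => n; apply: smash_ind => [y1 y2|x].
  apply: etrans (smash_smap_pair _ _ _ _) _; apply/esym.
  apply: etrans (congr1 (smash_smap g1 g2 n) (smash_smap_pair f1 f2 y1 y2)) _.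
  exact: smash_smap_pair.
apply: etrans (smash_smap_sect _ _ _) _; apply/esym.
apply: etrans (congr1 (smash_smap g1 g2 n) (smash_smap_sect f1 f2 x)) _.
exact: smash_smap_sect.
Qed.
End Smash.

(** The exterior smash product of finite retractive simplicial sets is finite *)

Lemma nondegenerate_repr (X : sset) n (x : X n) :
  exists m (f : dhom n m) (z : X m), ~ degenerate z /\ x = act f z.
Proof.
have [k] := ubnP n; elim: k n x => // k IH n x nk.
have [dx|ndx] := pselect (degenerate x); last first.
  by exists n, (did n), x; rewrite act_id.
case: n x / dx nk => n i z nk.
have [m [f [w [ndw ->]]]] := IH n z nk.
by exists m, (dcomp f (codegen i)), w; rewrite act_comp.
Qed.

Lemma coface_subproof n (i : 'I_n.+2) (j k : 'I_n.+1) :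
  (j <= k)%N -> (lift i j <= lift i k)%N.
Proof. by rewrite /= leq_bump2. Qed.

Definition coface n (i : 'I_n.+2) : dhom n n.+1 := mk_dhom (coface_subproof i).

Lemma dhom_factor n m (f : dhom n.+1 m) (i : 'I_n.+1) :
  f (widen_ord (leqnSn n.+1) i) = f (lift ord0 i) ->
  f = dcomp (dcomp f (coface (lift ord0 i))) (codegen i).
Proof.
move=> fi; apply: dhom_ext => j; rewrite /dcomp /coface /codegen !mk_dhomE.
have [ji|ji] := eqVneq j (lift ord0 i).
  rewrite {1}ji -fi; congr (f _); apply: val_inj => /=.
  by rewrite ji /= /bump /unbump /= add1n ltnSn subn1 /= ltnn.
congr (f _); apply: val_inj => /=.
have {ji} : (j : nat) != i.+1 by apply: contraNneq ji => e; apply/eqP/val_inj.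
by rewrite /bump /unbump /=; lia.
Qed.

Lemma common_collapse n m1 m2 (f1 : dhom n.+1 m1) (f2 : dhom n.+1 m2) :
  (m1 + m2 < n.+1)%N ->
  exists i : 'I_n.+1,
    f1 (widen_ord (leqnSn n.+1) i) = f1 (lift ord0 i) /\
    f2 (widen_ord (leqnSn n.+1) i) = f2 (lift ord0 i).
Proof.
move=> mn; apply: contrapT => /forallNP h.
have : forall k (kn : (k < n.+2)%N),
    (k <= f1 (Ordinal kn) + f2 (Ordinal kn))%N.
  elim=> // k IH kn.
  have {IH} := IH (ltnW kn).
  have kn1 : (k < n.+1)%N by [].
  have := h (Ordinal kn1).
  have -> : widen_ord (leqnSn n.+1) (Ordinal kn1) = Ordinal (ltnW kn)
    by exact: val_inj.
  have -> : lift ord0 (Ordinal kn1) = Ordinal kn by exact: val_inj.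
  have l1 : (f1 (Ordinal (ltnW kn)) <= f1 (Ordinal kn))%N
    by apply: dhomP => /=.
  have l2 : (f2 (Ordinal (ltnW kn)) <= f2 (Ordinal kn))%N
    by apply: dhomP => /=.
  move=> ne le.
  have {}ne : ~ ((f1 (Ordinal (ltnW kn)) : nat) = f1 (Ordinal kn) /\
                 (f2 (Ordinal (ltnW kn)) : nat) = f2 (Ordinal kn)).
    by move=> [e1 e2]; apply: ne; split; exact: val_inj.
  lia.
move=> /(_ n.+1 (ltnSn _)).
have := ltn_ord (f1 (Ordinal (ltnSn n.+1))).
have := ltn_ord (f2 (Ordinal (ltnSn n.+1))).
lia.
Qed.

Lemma smash_finite (X1 X2 : sset) (Y1 : retractive X1) (Y2 : retractive X2) :
  finite_retractive Y1 -> finite_retractive Y2 ->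
  finite_retractive (smash Y1 Y2).
Proof.
move=> fin1 fin2.
pose F (z1 : {n & Y1 n}) (z2 : {n & Y2 n}) n
    (f : dhom n (projT1 z1) * dhom n (projT1 z2)) : {n & smash Y1 Y2 n} :=
  existT (fun n => smash Y1 Y2 n) n
    (smash_pair (act f.1 (projT2 z1)) (act f.2 (projT2 z2))).
apply: (@sub_finite_set _ _
  (\bigcup_(z1 in new_simplices Y1) \bigcup_(z2 in new_simplices Y2)
   \bigcup_(n in `I_(projT1 z1 + projT1 z2).+1) (F z1 z2 n @` setT))).
  move=> [n z] [/= ndz nsz].
  elim/smash_ind: z ndz nsz => [y1 y2 ndz nsz|x _ []]; last by exists x.
  have [m1 [f1 [z1 [nd1 e1]]]] := nondegenerate_repr y1.
  have [m2 [f2 [z2 [nd2 e2]]]] := nondegenerate_repr y2.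
  subst y1 y2.
  exists (existT _ m1 z1).
    split=> //= -[x ex]; apply: nsz.
    rewrite -ex -sfun_act smash_sectl; eexists; reflexivity.
  exists (existT _ m2 z2).
    split=> //= -[x ex]; apply: nsz.
    rewrite -ex -sfun_act smash_sectr; eexists; reflexivity.
  exists n; last by exists (f1, f2).
  rewrite /= ltnS leqNgt; apply/negP => lt.
  case: n f1 f2 lt ndz {nsz} => // n f1 f2 lt [].
  have [i [/dhom_factor -> /dhom_factor ->]] := common_collapse f1 f2 lt.
  by rewrite !(act_comp _ (codegen i)) smash_pair_act.
apply: bigcup_finite => // z1 _; apply: bigcup_finite => // z2 _.
apply: bigcup_finite => [|n _]; first exact: finite_II.
exact/finite_image/finite_finset.
Qed.

Program Definition ext_smash (X1 X2 : sset) :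
    functor (prod_cat (Rf_cat X1) (Rf_cat X2)) (Rf_cat (sprod X1 X2)) :=
  @Functor (prod_cat (Rf_cat X1) (Rf_cat X2)) (Rf_cat (sprod X1 X2))
    (fun Y => exist _ (smash (sval Y.1) (sval Y.2))
                (smash_finite (svalP Y.1) (svalP Y.2)))
    (fun Y Z f => smash_map f.1 f.2) _ _.
Next Obligation. by move=> *; exact: smash_map_id. Qed.
Next Obligation. by move=> *; exact: smash_map_comp. Qed.

(* Main.v *)
From mathcomp Require Import all_boot all_order all_algebra.
From mathcomp Require Import zify lra.
From mathcomp Require Import all_classical all_reals topology normedtype.
Require Import Defs.
Import Order.TTheory GRing.Theory Num.Theory numFieldNormedType.Exports.

(* Cofibrations and pushouts are handled degree by degree: a pushout in R_f(X) is a
   levelwise pushout of sets, a property that smashing with a fixed object preserves.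

   Weak equivalences. By Ken Brown's argument it is enough to treat an injective
   f : Y -> Z; instead of a mapping cylinder, Y is embedded in Z x E, where E is a
   cofree simplicial set, so that maps into E extend along injections and Z x E -> Z has
   a section and is a simplicial homotopy equivalence. For an injective f with |f| a
   homotopy equivalence, the homotopy extension property makes |Y| a strong deformation
   retract of |Z|. This passes to products with X2 and W and to pushouts, so the inclusion
   of Z x X2 u Y x W into Z x W is again an injective homotopy equivalence, hence a strong
   deformation retract; pushing it out along Z x X2 u Y x W -> Y ^ W yields Y ^ W -> Z ^ W.

   Products with an infinite W are handled without comparing |Y x W| with |Y| x |W| as
   spaces: the map |Y| x simplex -> |Y x W| attached to a simplex of W is continuous, and
   this is enough to multiply a homotopy of |Y| by |W|. *)

Set Implicit Arguments.
Unset Strict Implicit.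
Unset Printing Implicit Defensive.

Local Open Scope classical_set_scope.
Local Open Scope quotient_scope.
Local Open Scope ring_scope.

(** * Simplices *)

Section SimplexTopology.
Variable R : realType.
Notation simplex := (std_simplex R).

(** A homotopy inverse of [|Y| -> |Z|] carries no control over products or pushouts. A strong
    deformation retraction consists of maps and a homotopy that are trivial on [|Y|], so it can be
    multiplied by a simplicial set and glued without repairing any coherence; homotopy extension is
    there to produce one. Finiteness is of no help for weak equivalences: [X1] and [X2] are
    arbitrary, so objects over them may be infinite, and [Z x E] usually leaves [R_f(X)]. The
    statements about weak equivalences therefore concern all of [R(X)], and simplices are attached
    under Zorn's lemma. An ordinary cylinder on [Y] would have to be collapsed over [X] to become an
    object of [R(X)]; for [Z x E] a map [X -> E] is enough, and it extends over [Z]. Realizations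
    carry the plain quotient topology, so products with a space are controlled only for locally
    compact Hausdorff factors, such as a simplex or the real line of times. *)

Definition bary n (t : simplex n) (i : 'I_n.+1) : R := set_val t ord0 i.

Lemma bary_ge0 n (t : simplex n) i : 0 <= bary t i.
Proof. by have /set_mem[t0 _] := valP t; exact: t0. Qed.

Lemma bary_sum n (t : simplex n) : \sum_i bary t i = 1.
Proof. by have /set_mem[_ t1] := valP t; exact: t1. Qed.

Lemma bary_inj n (t t' : simplex n) : bary t =1 bary t' -> t = t'.
Proof. by move=> tt'; apply/val_inj/rowP => i; exact: tt'. Qed.

Lemma mk_simplex_subproof n (u : 'I_n.+1 -> R) :
  (forall i, 0 <= u i) -> \sum_i u i = 1 -> \row_i u i \in simplex n.
Proof.
move=> u0 u1; apply/mem_set; split=> [i|]; first by rewrite mxE.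
by rewrite -u1; apply: eq_bigr => i _; rewrite mxE.
Qed.

Definition mk_simplex n (u : 'I_n.+1 -> R) (u0 : forall i, 0 <= u i)
  (u1 : \sum_i u i = 1) : simplex n := SigSub (mk_simplex_subproof u0 u1).

Lemma mk_simplexE n (u : 'I_n.+1 -> R) u0 u1 i :
  bary (@mk_simplex n u u0 u1) i = u i.
Proof. by rewrite /bary /= mxE. Qed.

Lemma bary_map m n (f : dhom m n) (t : simplex m) j :
  bary (simplex_map f t) j = \sum_(i | f i == j) bary t i.
Proof. by rewrite /bary /= mxE. Qed.

Lemma simplex_map_id n (t : simplex n) : simplex_map (did n) t = t.
Proof.
apply: bary_inj => j; rewrite bary_map (big_pred1 j) // => i.
by rewrite mk_dhomE.
Qed.

Lemma simplex_map_comp m n p (g : dhom n p) (f : dhom m n) (t : simplex m) :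
  simplex_map (dcomp g f) t = simplex_map g (simplex_map f t).
Proof.
apply: bary_inj => j; rewrite !bary_map.
rewrite (partition_big f (fun k => g k == j)) /=; last first.
  by move=> i; rewrite mk_dhomE.
apply: eq_bigr => k /eqP gk; rewrite bary_map; apply: eq_bigl => i.
by rewrite mk_dhomE; case: (f i =P k) => [->|]; rewrite ?gk ?eqxx ?andbF.
Qed.

Lemma continuous_bary n (i : 'I_n.+1) : continuous (fun t : simplex n => bary t i).
Proof.
move=> t; apply: (@continuous_comp _ _ _ (set_val : simplex n -> 'rV[R]_n.+1)
  (fun v => v ord0 i)); first exact: initial_continuous.
exact: coord_continuous.
Qed.

Lemma continuous_simplex (T : topologicalType) n (g : T -> simplex n) :
  (forall i, continuous (fun x => bary (g x) i)) -> continuous g.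
Proof.
move=> cg; apply: (@continuous_comp_initial (set_type (simplex n)) T 'rV[R]_n.+1 set_val g).
move=> x A [P nP PA]; rewrite nbhs_filterE /fmap /=.
have : \forall y \near x, forall j : 'I_n.+1, P ord0 j (bary (g y) j).
  by apply: filter_forall => j; exact: (cg j x (P ord0 j) (nP ord0 j)).
by apply: filterS => y yP; apply: PA => i j; rewrite ord1; exact: yP.
Qed.

Lemma continuous_simplex_map m n (f : dhom m n) :
  continuous (@simplex_map R m n f).
Proof.
apply: continuous_simplex => j.
rewrite (_ : (fun x => _) = (fun t => \sum_(i | f i == j) bary t i)).
  apply: (continuous_big add_continuous) => i _; exact: continuous_bary.
by apply/funext => t; rewrite bary_map.
Qed.

Lemma simplex_hausdorff n : hausdorff_space (simplex n).
Proof.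
move=> p q pq; apply: val_inj; apply: (@norm_hausdorff R 'rV[R]_n.+1) => A B nA nB.
have := pq (set_val @^-1` A) (set_val @^-1` B).
case; [exact: (@initial_continuous (simplex n) _ set_val)|
       exact: (@initial_continuous (simplex n) _ set_val)|].
by move=> x [? ?]; exists (val x).
Qed.

Lemma simplex_compact n : compact [set: simplex n].
Proof.
have cK : compact (simplex n).
  apply: (@subclosed_compact 'rV[R]_n.+1 (simplex n)
    [set v : 'rV[R]_n.+1 | forall i, `[0,1]%classic (v ord0 i)]).
  - have -> : (simplex n : set _) =
      (\bigcap_(i in [set: 'I_n.+1]) ((fun v : 'rV[R]_n.+1 => v ord0 i) @^-1` [set x | 0 <= x]))
      `&` ((fun v : 'rV[R]_n.+1 => \sum_i v ord0 i) @^-1` [set 1]).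
      apply/seteqP; split=> v /= [v0 v1]; split=> // i; first by move=> _; exact: v0.
      exact: (v0 i).
    apply: closedI; [apply: closed_bigI => i _|].
      apply: preimage_closed => [v _|]; [exact: coord_continuous|exact: closed_ge].
    apply: preimage_closed => [v _|]; last exact: closed_eq.
    by move: v; apply: (continuous_big add_continuous) => i _; exact: coord_continuous.
  - apply: (@rV_compact R n.+1 (fun _ => `[0,1]%classic)) => _; exact: segment_compact.
  - move=> v [v0 v1] i /=; rewrite in_itv /= v0 -v1 (bigD1 i) //= lerDl.
    exact: sumr_ge0.
move=> F FF _.
have [|v [Kv cv]] := cK (set_val @ F) _.
  apply: (@filterS _ F _ setT) => [x _|]; last exact: filterT.
  exact: (set_mem (valP x)).
exists (SigSub (mem_set Kv)); split=> // A B FA [C [[D oD DC] Cv CB]].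
have [] := cv (set_val @` A) D.
- by apply: (@filterS _ F _ A) => // x Ax; exists x.
- apply: open_nbhs_nbhs; split=> //.
  by move: Cv; rewrite -DC.
- move=> _ [[x Ax <-] Dx]; exists x; split=> //; apply: CB.
  by rewrite -DC.
Qed.

End SimplexTopology.

(** * Maps of simplices and common refinements *)

Section SimplexCombinatorics.
Variable R : realType.
Notation simplex := (std_simplex R).

Lemma sum_bary_map m n (h : dhom m n) (v : simplex m) (P : pred 'I_n.+1) :
  \sum_(j | P j) bary (simplex_map h v) j = \sum_(k | P (h k)) bary v k.
Proof.
rewrite [RHS](partition_big h P) //=; apply: eq_bigr => j Pj.
by rewrite bary_map; apply: eq_bigl => k; case: (h k =P j) => [->|]; rewrite ?Pj ?andbF.
Qed.

(* The partial sums of a positive [v] increase strictly, so they determine the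
   initial segments [h^-1([0, j])]. *)
Lemma simplex_map_positive_inj m n (h h' : dhom m n) (v : simplex m) :
  (forall i, 0 < bary v i) -> simplex_map h v = simplex_map h' v -> h = h'.
Proof.
move=> v0 hv; apply: dhom_ext => i; apply/eqP/negPn/negP => hi.
wlog lt : h h' hv hi / (h i < h' i)%N.
  move=> W; have [|le] := ltnP (h i) (h' i); first exact: W.
  apply: (W h' h) => //; first by rewrite eq_sym.
  by rewrite ltn_neqAle le andbT; apply: contra hi => /eqP e; apply/eqP/val_inj.
have := congr1 (fun t => \sum_(j : 'I_n.+1 | (j <= h i)%N) bary t j) hv.
rewrite !sum_bary_map (bigD1 i) //= => e.
have : \sum_(k | (h' k <= h i)%N) bary v k <=
       \sum_(k | (h k <= h i)%N && (k != i)) bary v k.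
  rewrite big_mkcond [leRHS]big_mkcond; apply: ler_sum => k _.
  case: ifPn => h'k; last by case: ifP => // _; exact: ltW.
  have ki : (k < i)%N.
    by rewrite ltnNge; apply/negP => /(dhomP h'); lia.
  have -> : (h k <= h i)%N by apply: dhomP; exact: ltnW.
  by rewrite (_ : k != i) //; apply: contraTneq ki => ->; rewrite ltnn.
by rewrite -e; have := v0 i; lra.
Qed.

Lemma simplex_map_fix n (e : dhom n n) (t : simplex n) :
  (forall k, bary t k != 0 -> e k = k) -> simplex_map e t = t.
Proof.
move=> et; apply: bary_inj => j; rewrite bary_map big_mkcond /=.
rewrite -[RHS](big_pred1_eq +%R j (bary t)) [RHS]big_mkcond /=.
apply: eq_bigr => k _; have [->|/et ->//] := eqVneq (bary t k) 0.
by rewrite !if_same.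
Qed.

Lemma avoid_subproof n (i : 'I_n.+2) : (minn i n < n.+1)%N.
Proof. by rewrite ltnS geq_minr. Qed.

(* Moves the vertex [i] to a neighbour and fixes all others. *)
Definition avoid n (i : 'I_n.+2) : dhom n.+1 n.+1 :=
  dcomp (coface i) (codegen (Ordinal (avoid_subproof i))).

Lemma avoid_fix n (i k : 'I_n.+2) : k != i -> avoid i k = k.
Proof.
move=> ki; rewrite !mk_dhomE; apply: val_inj => /=.
have : (k : nat) != i by apply: contraNneq ki => e; apply/eqP/val_inj.
have := ltn_ord i; have := ltn_ord k.
by rewrite /bump /unbump /=; lia.
Qed.

Lemma simplex_map_avoid n (i : 'I_n.+2) (t : simplex n.+1) :
  bary t i = 0 -> simplex_map (avoid i) t = t.
Proof.
move=> ti; apply: simplex_map_fix => k; have [->|ki _] := eqVneq k i.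
  by rewrite ti eqxx.
exact: avoid_fix.
Qed.

(** As long as a coordinate vanishes, the point lies on the opposite face, where the induction goes
    down one dimension. *)
Lemma positive_repr n (t : simplex n) :
  exists m (h : dhom m n) (v : simplex m),
    (forall i, 0 < bary v i) /\ simplex_map h v = t.
Proof.
elim: n t => [|n IH] t.
  exists 0, (did 0), t; rewrite simplex_map_id; split=> // i.
  by have := bary_sum t; rewrite big_ord_recl big_ord0 addr0 (ord1 i) => ->; exact: ltr01.
have [t0|] := pselect (forall i, 0 < bary t i).
  by exists n.+1, (did n.+1), t; rewrite simplex_map_id.
move=> /existsNP[i /negP]; rewrite lt_neqAle bary_ge0 andbT negbK eq_sym => /eqP ti.
have [m [h [v [v0 hv]]]] := IH (simplex_map (codegen (Ordinal (avoid_subproof i))) t).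
exists m, (dcomp (coface i) h), v; split=> //.
by rewrite simplex_map_comp hv -simplex_map_comp; exact: simplex_map_avoid.
Qed.

Definition fcons T p (a : T) (f : 'I_p.+1 -> T) (i : 'I_p.+2) : T :=
  oapp f a (unlift ord0 i).

Lemma fcons0 T p (a : T) (f : 'I_p.+1 -> T) : fcons a f ord0 = a.
Proof. by rewrite /fcons unlift_none. Qed.

Lemma fconsS T p (a : T) (f : 'I_p.+1 -> T) i : fcons a f (lift ord0 i) = f i.
Proof. by rewrite /fcons liftK. Qed.

Lemma fcons_mono p m (a : 'I_m.+1) (f : 'I_p.+1 -> 'I_m.+1) :
  (forall i, a <= f i)%N -> {homo f : i j / (i <= j)%N} ->
  {homo fcons a f : i j / (i <= j)%N}.
Proof.
move=> af fm i j; case: (unliftP ord0 i) => [i'|] ->; case: (unliftP ord0 j) => [j'|] ->;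
  rewrite ?fcons0 ?fconsS //.
by rewrite !lift0 ltnS; exact: fm.
Qed.

Lemma sum_fcons p m (a : 'I_m.+1) (f : 'I_p.+1 -> 'I_m.+1) (c : R) (u : 'I_p.+1 -> R) j :
  \sum_(i | fcons a f i == j) fcons c u i =
  (if a == j then c else 0) + \sum_(i | f i == j) u i.
Proof.
rewrite big_mkcond big_ord_recl /= !fcons0; congr (_ + _).
by rewrite [RHS]big_mkcond; apply: eq_bigr => i _; rewrite !fconsS.
Qed.

(** A transport plan with marginals [s] and [t] whose mass sits on a monotone lattice path: cell [i]
    of the path lies at [(f i, g i)] and carries [u i]. *)
Definition mergeable p m n (s : 'I_m.+1 -> R) (t : 'I_n.+1 -> R) :=
  exists (u : 'I_p.+1 -> R) (f : 'I_p.+1 -> 'I_m.+1) (g : 'I_p.+1 -> 'I_n.+1),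
  [/\ (forall i, 0 <= u i),
      {homo f : i j / (i <= j)%N}, {homo g : i j / (i <= j)%N},
      (forall j, \sum_(i | f i == j) u i = s j) &
      (forall j, \sum_(i | g i == j) u i = t j)].

Lemma mergeableC p m n (s : 'I_m.+1 -> R) (t : 'I_n.+1 -> R) :
  mergeable p s t -> mergeable p t s.
Proof. by move=> [u [f [g [? ? ? ? ?]]]]; exists u, g, f. Qed.

(** The corner takes all of [s ord0]: that row is finished, and the column keeps what remains of
    [t ord0]. *)
Lemma mergeable_step p m n (s : 'I_m.+2 -> R) (t : 'I_n.+1 -> R) :
  (forall i, 0 <= s i) ->
  mergeable p (fun i => s (lift ord0 i))
    (fun j => if j == ord0 then t ord0 - s ord0 else t j) ->
  mergeable p.+1 s t.
Proof.
move=> s0 [u [f [g [u0 fm gm fu gu]]]].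
exists (fcons (s ord0) u), (fcons ord0 (fun i => lift ord0 (f i))), (fcons ord0 g); split.
- by move=> i; case: (unliftP ord0 i) => [i'|] ->; rewrite ?fcons0 ?fconsS.
- by apply: fcons_mono => // i j ij; rewrite !lift0 ltnS; exact: fm.
- exact: fcons_mono.
- move=> j; rewrite sum_fcons; case: (unliftP ord0 j) => [j'|] ->.
    rewrite -fu (negbTE (neq_lift _ _)) add0r; apply: eq_bigl => i.
    by rewrite (inj_eq (@lift_inj _ _)).
  by rewrite eqxx big_pred0 ?addr0 // => i; rewrite eq_sym (negbTE (neq_lift _ _)).
- move=> j; rewrite sum_fcons gu eq_sym; case: eqP => [->|_]; last by rewrite add0r.
  by rewrite addrC subrK.
Qed.

(* By the north-west corner rule. *)
Lemma merge p m n (s : 'I_m.+1 -> R) (t : 'I_n.+1 -> R) :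
  (m + n = p)%N -> (forall i, 0 <= s i) -> (forall j, 0 <= t j) ->
  \sum_i s i = \sum_j t j -> mergeable p s t.
Proof.
have base q (a : 'I_1 -> R) (b : 'I_q.+1 -> R) : (forall j, 0 <= b j) ->
    \sum_i a i = \sum_j b j -> mergeable q a b.
  move=> b0; rewrite big_ord_recl big_ord0 addr0 => ab.
  exists b, (fun _ => ord0), id; split=> // j; last by rewrite big_pred1_eq.
  by rewrite (ord1 j) ab; apply: eq_bigl => i; rewrite eqxx.
elim: p m n s t => [|p IH] [|m] [|n] s t mnp s0 t0 st; try by lia.
- by apply: base.
- by rewrite (_ : p.+1 = n.+1); [apply: base|lia].
- by rewrite (_ : p.+1 = m.+1); [apply/mergeableC/base|lia].
have sum_sub q (a : 'I_q.+1 -> R) c :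
    \sum_j (if j == ord0 then a ord0 - c else a j) = \sum_j a j - c.
  by rewrite big_ord_recl [in RHS]big_ord_recl /= addrAC.
have [le|/ltW le] := leP (s ord0) (t ord0).
  apply: mergeable_step => //; apply: IH => //; first by lia.
    by move=> j; case: eqP => // _; rewrite subr_ge0.
  by rewrite sum_sub -st [in RHS]big_ord_recl addrC addKr.
apply/mergeableC/mergeable_step => //; apply: IH => //; first by lia.
  by move=> j; case: eqP => // _; rewrite subr_ge0.
by rewrite sum_sub st [in RHS]big_ord_recl addrC addKr.
Qed.

Lemma simplex_merge m n (s : simplex m) (t : simplex n) :
  exists (f : dhom (m + n) m) (g : dhom (m + n) n) (u : simplex (m + n)),
    simplex_map f u = s /\ simplex_map g u = t.
Proof.
have [|u [f [g [u0 fm gm fu gu]]]] := @merge (m + n) m n (bary s) (bary t) erefl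
  (@bary_ge0 _ _ s) (@bary_ge0 _ _ t); first by rewrite !bary_sum.
have u1 : \sum_i u i = 1.
  rewrite -(bary_sum s) (partition_big f xpredT) //=.
  by apply: eq_bigr => j _; exact: fu.
exists (mk_dhom fm), (mk_dhom gm), (mk_simplex u0 u1).
split; apply: bary_inj => j; rewrite bary_map -?fu -?gu;
  by apply: eq_big => i; rewrite ?mk_dhomE // mk_simplexE.
Qed.

(** Two points are merged, then the vertices of weight zero are discarded. Positivity of [v] is what
    lets [simplex_map_positive_inj] cancel it later. *)
Lemma common_refinement m n (s : simplex m) (t : simplex n) :
  exists p (h : dhom p m) (k : dhom p n) (v : simplex p),
    [/\ forall i, 0 < bary v i, simplex_map h v = s & simplex_map k v = t].
Proof.
have [f [g [u [<- <-]]]] := simplex_merge s t.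
have [p [h [v [v0 <-]]]] := positive_repr u.
by exists p, (dcomp f h), (dcomp g h), v; rewrite !simplex_map_comp.
Qed.
End SimplexCombinatorics.

(** * Realizations *)

Section Topology.
Lemma compact_locally_compact (T : topologicalType) :
  compact [set: T] -> locally_compact [set: T].
Proof.
move=> cT x _; rewrite withinET; exists setT; first exact: filterT.
by split=> //; exact: closedT.
Qed.

Lemma locally_compact_prod (S T : topologicalType) :
  locally_compact [set: S] -> locally_compact [set: T] ->
  locally_compact [set: S * T].
Proof.
move=> lS lT [x y] _; rewrite withinET.
have [A] := lS x I; rewrite withinET => nA [cA clA].
have [B] := lT y I; rewrite withinET => nB [cB clB].
exists (A `*` B); first by exists (A, B).
split; first exact: compact_setX.
rewrite (_ : A `*` B = fst @^-1` A `&` snd @^-1` B) //.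
apply: closedI.
  by apply: preimage_closed => // -[a b] _; exact: cvg_fst.
by apply: preimage_closed => // -[a b] _; exact: cvg_snd.
Qed.

Lemma hausdorff_prod (S T : topologicalType) :
  hausdorff_space S -> hausdorff_space T -> hausdorff_space (S * T)%type.
Proof.
move=> hS hT [x y] [x' y'] c; congr (_, _).
  apply: hS => A B nA nB.
  have [||[a b] /= [[]]] := c (A `*` setT) (B `*` setT).
  - by exists (A, setT) => //; split=> //; exact: filterT.
  - by exists (B, setT) => //; split=> //; exact: filterT.
  by move=> Aa _ [Ba _]; exists a.
apply: hT => A B nA nB.
have [||[a b] /= [[]]] := c (setT `*` A) (setT `*` B).
- by exists (setT, A) => //; split=> //; exact: filterT.
- by exists (setT, B) => //; split=> //; exact: filterT.
by move=> _ Ab [_ Bb]; exists b.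
Qed.

Lemma continuous_pair (S T U : topologicalType) (f : S -> T) (g : S -> U) :
  continuous f -> continuous g -> continuous (fun x => (f x, g x)).
Proof. by move=> cf cg x; apply: cvg_pair; [exact: cf|exact: cg]. Qed.

Lemma continuous_comp_fun (S T U : topologicalType) (g : T -> U) (f : S -> T) :
  continuous g -> continuous f -> continuous (fun x => g (f x)).
Proof. by move=> cg cf x; apply: continuous_comp; [exact: cf|exact: cg]. Qed.

Lemma continuous_fst (S T : topologicalType) : continuous (@fst S T).
Proof. by move=> -[a b]; exact: cvg_fst. Qed.

Lemma continuous_snd (S T : topologicalType) : continuous (@snd S T).
Proof. by move=> -[a b]; exact: cvg_snd. Qed.

Lemma continuous_id (S : topologicalType) : continuous (fun x : S => x).
Proof. by move=> x; exact: cvg_id. Qed.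

(** Continuity of [g j] is asked only when piece [j] is nonempty: for the side of a prism, it is
    derived from the existence of a point on that side. *)
Lemma continuous_paste (J : finType) (S T : topologicalType) (f : S -> T)
    (A : J -> set S) (g : J -> S -> T) :
  (forall j, closed (A j)) -> (forall j x, A j x -> continuous (g j)) ->
  (forall j x, A j x -> f x = g j x) -> (forall x, exists j, A j x) ->
  continuous f.
Proof.
move=> clA cg fg cov; apply/continuous_closedP => B clB.
rewrite (_ : f @^-1` B = \bigcup_(j in [set: J]) (A j `&` g j @^-1` B)).
  apply: closed_bigcup => [|j _]; first exact: finite_finset.
  have [[x Ajx]|nA] := pselect (exists x, A j x).
    by apply: closedI => //; apply: preimage_closed => // y _; exact: cg Ajx _.
  rewrite (_ : _ `&` _ = set0); first exact: closed0.
  by apply/seteqP; split=> // x [Ajx _]; apply: nA; exists x.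
apply/seteqP; split=> [x /= Bfx|x [j _ [Ajx /=]]]; last by rewrite (fg j x).
by have [j Ajx] := cov x; exists j => //; split=> //=; rewrite -(fg j x).
Qed.
End Topology.

(** * The realization as a quotient of its cells *)

Section Realization.
Variable R : realType.
Notation simplex := (std_simplex R).

Lemma real_pt_act (X : sset) m n (f : dhom m n) (x : X n) (t : simplex m) :
  real_pt (act f x) t = real_pt x (simplex_map f t).
Proof. exact/quot_rel/CellRel. Qed.

Lemma real_ind (X : sset) (P : realization R X -> Prop) :
  (forall n (x : X n) (t : simplex n), P (real_pt x t)) -> forall z, P z.
Proof. by move=> h; apply: quotP => -[[n x] t]; exact: h. Qed.

Lemma continuous_real_pt (X : sset) n (x : X n) :
  continuous (fun t : simplex n => real_pt x t : realization R X).
Proof.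
apply: (@continuous_comp_fun _ (cells R X) _ \pi_(realization R X) (cell x)).
  exact: pi_continuous.
by move=> t A.
Qed.

Definition real_lift (X : sset) U (phi : forall n, X n -> simplex n -> U) :
    realization R X -> U :=
  @quot_lift _ (@cell_rel R X) U
    (fun c => phi _ (projT2 (projT1 c)) (projT2 c)).

Lemma real_liftE (X : sset) U (phi : forall n, X n -> simplex n -> U) :
  (forall m n (f : dhom m n) (x : X n) t,
    phi m (act f x) t = phi n x (simplex_map f t)) ->
  forall n (x : X n) t, real_lift phi (real_pt x t) = phi n x t.
Proof.
by move=> phiE n x t; rewrite /real_lift quot_liftE // => _ _ [*]; exact: phiE.
Qed.

Lemma real_continuous (X : sset) (T : topologicalType) (f : realization R X -> T) :
  (forall n (x : X n), continuous (fun t => f (real_pt x t))) -> continuous f.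
Proof.
move=> cf; apply/quotient_continuous => -[[n x] t] A nA.
exact: (cf n x t A nA).
Qed.

Import ArrowAsCompactOpen.

(* A quotient map times a locally compact space is a quotient map. *)
Lemma real_prod_continuous (X : sset) (P T : topologicalType)
    (f : realization R X * P -> T) :
  locally_compact [set: P] -> hausdorff_space P ->
  (forall n (x : X n), continuous (fun q : simplex n * P => f (real_pt x q.1, q.2))) ->
  continuous f.
Proof.
move=> lP hP cf; rewrite (_ : f = uncurry (curry f)); last first.
  by apply/funext => -[].
apply: continuous_uncurry => //.
  apply: real_continuous => n x.
  have := continuous_curry_fun (cf n x).
  rewrite (_ : curry _ = fun t => curry f (real_pt x t)) //.
apply: real_ind => n x t.
by have [_ /(_ t)] := continuous_curry (cf n x).
Qed.

Lemma realization_map_continuous (X Y : sset) (f : smap X Y) :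
  continuous (realization_map f : realization R X -> realization R Y).
Proof.
apply: real_continuous => n x.
rewrite (_ : (fun t => _) = real_pt (f n x)); first exact: continuous_real_pt.
by apply/funext => t; rewrite realization_mapE.
Qed.

Lemma continuous_realization_map (T : topologicalType) (X Y : sset) (f : smap X Y)
    (u : T -> realization R X) :
  continuous u -> continuous (fun x => realization_map f (u x)).
Proof. exact/continuous_comp_fun/realization_map_continuous. Qed.

Lemma realization_map_comp (X Y Z : sset) (g : smap Y Z) (f : smap X Y) :
  realization_map (scomp g f) =
  realization_map g \o realization_map f :> (realization R X -> realization R Z).
Proof.
by apply/funext; apply: real_ind => n x t; rewrite /= !realization_mapE.
Qed.

Lemma realization_map_id (X : sset) :
  realization_map (sid X) = id :> (realization R X -> realization R X).
Proof. by apply/funext; apply: real_ind => n x t; rewrite realization_mapE. Qed.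

End Realization.

(** * Realization of products *)

Program Definition sfst (X Y : sset) : smap (sprod X Y) X :=
  @SMap (sprod X Y) X (fun _ x => x.1) _.
Next Obligation. by []. Qed.

Program Definition ssnd (X Y : sset) : smap (sprod X Y) Y :=
  @SMap (sprod X Y) Y (fun _ x => x.2) _.
Next Obligation. by []. Qed.

Section Product.
Variable R : realType.
Notation simplex := (std_simplex R).
Variables Y W : sset.

Definition prod_pt p (y : Y p) (w : W p) (u : simplex p) : realization R (sprod Y W) :=
  @real_pt R (sprod Y W) p (y, w) u.

Lemma prod_pt_act p q (h : dhom q p) (y : Y p) (w : W p) (u : simplex q) :
  prod_pt (act h y) (act h w) u = prod_pt y w (simplex_map h u).
Proof. exact: (@real_pt_act R (sprod Y W) q p h (y, w) u). Qed.

(* Passing to a common refinement [v], whose positivity makes the maps to [s] and [t]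
   unique. *)
Lemma prod_pt_unique m n p q (y : Y m) (w : W n) (f : dhom p m) (g : dhom p n)
    (f' : dhom q m) (g' : dhom q n) (u : simplex p) (u' : simplex q) :
  simplex_map f u = simplex_map f' u' -> simplex_map g u = simplex_map g' u' ->
  prod_pt (act f y) (act g w) u = prod_pt (act f' y) (act g' w) u'.
Proof.
have [r [h [k [v [v0 <- <-]]]]] := common_refinement u u'.
rewrite -!simplex_map_comp => /(simplex_map_positive_inj v0) ef.
move=> /(simplex_map_positive_inj v0) eg.
by rewrite -!prod_pt_act -!act_comp ef eg.
Qed.

Lemma pair_pt_ex m n (y : Y m) (s : simplex m) (w : W n) (t : simplex n) :
  exists z, forall p (f : dhom p m) (g : dhom p n) (u : simplex p),
    simplex_map f u = s -> simplex_map g u = t -> z = prod_pt (act f y) (act g w) u.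
Proof.
have [f [g [u [<- <-]]]] := simplex_merge s t.
by exists (prod_pt (act f y) (act g w) u) => *; exact: prod_pt_unique.
Qed.

Definition pair_pt m n (y : Y m) (s : simplex m) (w : W n) (t : simplex n) :=
  projT1 (cid (pair_pt_ex y s w t)).

Lemma pair_ptE m n p (y : Y m) (w : W n) (f : dhom p m) (g : dhom p n) (u : simplex p) :
  pair_pt y (simplex_map f u) w (simplex_map g u) = prod_pt (act f y) (act g w) u.
Proof. by rewrite /pair_pt; case: cid => z /= h; exact: h. Qed.

(* The inverse of the continuous bijection |Y x W| -> |Y| x |W|, which need not be
   continuous. *)
Definition rpair (a : realization R Y) (b : realization R W) :
    realization R (sprod Y W) :=
  real_lift (fun m y s => real_lift (fun n w t => pair_pt y s w t) b) a.

Lemma rpair_pair_pt m n (y : Y m) (s : simplex m) (w : W n) (t : simplex n) :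
  rpair (real_pt y s) (real_pt w t) = pair_pt y s w t.
Proof.
have compat a b (h : dhom a b) k (z : Y k) v (x : W b) r :
    pair_pt z v (act h x) r = pair_pt z v x (simplex_map h r).
  have [f [g [u [<- <-]]]] := simplex_merge v r.
  by rewrite pair_ptE -act_comp -pair_ptE simplex_map_comp.
have inner k (z : Y k) v c (x : W c) q :
    real_lift (fun n w t => pair_pt z v w t) (real_pt x q) = pair_pt z v x q.
  by apply: real_liftE => *; exact: compat.
rewrite /rpair real_liftE ?inner // => a b h x r.
elim/real_ind: (real_pt w t) => c z q; rewrite !inner.
have [f [g [u [<- <-]]]] := simplex_merge r q.
by rewrite pair_ptE -act_comp -pair_ptE simplex_map_comp.
Qed.

Lemma rpairE p (y : Y p) (w : W p) (u : simplex p) :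
  rpair (real_pt y u) (real_pt w u) = prod_pt y w u.
Proof.
rewrite rpair_pair_pt; have := pair_ptE y w (did p) (did p) u.
by rewrite !act_id !simplex_map_id.
Qed.

Lemma real_joint (a : realization R Y) (b : realization R W) :
  exists p (y : Y p) (w : W p) (u : simplex p), a = real_pt y u /\ b = real_pt w u.
Proof.
elim/real_ind: a => m y s; elim/real_ind: b => n w t.
have [f [g [u [<- <-]]]] := simplex_merge s t.
by exists (m + n)%N, (act f y), (act g w), u; rewrite !real_pt_act.
Qed.

Lemma rpair_eta z :
  rpair (realization_map (sfst Y W) z) (realization_map (ssnd Y W) z) = z.
Proof. by elim/real_ind: z => n [y w] t; rewrite !realization_mapE rpairE. Qed.

(* The cells of the product are covered by the compact images of the simplices of the
   (m, n)-shuffles. *)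
Lemma rpair_cell_continuous n (w : W n) :
  continuous (fun q : realization R Y * simplex n => rpair q.1 (real_pt w q.2)).
Proof.
apply: real_prod_continuous => [||m y].
- exact/compact_locally_compact/simplex_compact.
- exact: simplex_hausdorff.
apply/continuous_closedP => B clB.
pose J := (dhom (m + n) m * dhom (m + n) n)%type.
pose F (j : J) (u : simplex (m + n)) := (simplex_map j.1 u, simplex_map j.2 u).
pose A (j : J) := (fun u => prod_pt (act j.1 y) (act j.2 w) u) @^-1` B.
rewrite (_ : _ @^-1` B = \bigcup_(j in [set: J]) (F j @` A j)); last first.
  apply/seteqP; split=> [[s t] /= Bst|_ [j _ [u Bu <-]] /=].
    have [f [g [u [fu gu]]]] := simplex_merge s t.
    exists (f, g) => //; exists u; last by rewrite /F /= fu gu.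
    by rewrite /A /= -pair_ptE fu gu -rpair_pair_pt.
  by rewrite rpair_pair_pt pair_ptE.
apply: closed_bigcup => [|j _]; first exact: finite_finset.
apply: compact_closed; first by apply: hausdorff_prod; exact: simplex_hausdorff.
apply: continuous_compact.
  apply: continuous_subspaceT; apply: continuous_pair; exact: continuous_simplex_map.
apply: (subclosed_compact _ (@simplex_compact R (m + n))) => //.
apply: preimage_closed => // u _.
exact: (@continuous_real_pt R (sprod Y W)).
Qed.
End Product.

Section ProductMaps.
Variable R : realType.

Lemma rpair_map (Y W Y' W' : sset) (f : smap Y Y') (g : smap W W')
    (a : realization R Y) (b : realization R W) :
  realization_map (sprod_map f g) (rpair a b) =
  rpair (realization_map f a) (realization_map g b).
Proof.
have [p [y [w [u [-> ->]]]]] := real_joint a b.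
by rewrite rpairE !realization_mapE rpairE.
Qed.

(* Continuous although [rpair] need not be: the second coordinate stays in its cell. *)
Lemma rpair_continuous (Y Z W : sset) (P : topologicalType)
    (phi : realization R Y * P -> realization R Z) :
  locally_compact [set: P] -> hausdorff_space P -> continuous phi ->
  continuous (fun q : realization R (sprod Y W) * P =>
    rpair (phi (realization_map (sfst Y W) q.1, q.2)) (realization_map (ssnd Y W) q.1)).
Proof.
move=> lP hP cphi; apply: real_prod_continuous => // n [y w].
rewrite (_ : (fun q => _) =
  (fun q : realization R Z * std_simplex R n => rpair q.1 (real_pt w q.2)) \o
  (fun q => (phi (real_pt y q.1, q.2), q.1))); last first.
  by apply/funext => q /=; rewrite !realization_mapE.
move=> q; apply: continuous_comp; last exact: rpair_cell_continuous.
move: q; apply: continuous_pair; last exact: continuous_fst.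
apply: (continuous_comp_fun cphi); apply: continuous_pair; last exact: continuous_snd.
apply: continuous_comp_fun; [exact: continuous_real_pt|exact: continuous_fst].
Qed.
End ProductMaps.

(** * Retraction of a prism onto its bottom and sides *)

Section RealFunctions.
Variables (R : realType) (T : topologicalType).
Implicit Types f g : T -> R.

Lemma continuous_add f g : continuous f -> continuous g ->
  continuous (fun x => f x + g x).
Proof. by move=> cf cg x; apply: (@cvgD _ R^o); [exact: cf|exact: cg]. Qed.

Lemma continuous_opp f : continuous f -> continuous (fun x => - f x).
Proof. by move=> cf x; apply: (@cvgN _ R^o); exact: cf. Qed.

Lemma continuous_mul f g : continuous f -> continuous g ->
  continuous (fun x => f x * g x).
Proof. by move=> cf cg x; apply: (@cvgM R); [exact: cf|exact: cg]. Qed.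

Lemma continuous_inv f : (forall x, f x != 0) -> continuous f ->
  continuous (fun x => (f x)^-1).
Proof. by move=> f0 cf x; apply: cvgV => //; exact: cf. Qed.

Lemma continuous_maxr f g : continuous f -> continuous g ->
  continuous (fun x => Num.max (f x) (g x)).
Proof. by move=> cf cg; exact: max_fun_continuous. Qed.

Lemma continuous_minr f g : continuous f -> continuous g ->
  continuous (fun x => Num.min (f x) (g x)).
Proof. by move=> cf cg; exact: min_fun_continuous. Qed.
End RealFunctions.

Section Clamp.
Variable R : realType.

(** Time runs over the whole real line; composing with [clamp] makes a homotopy stationary outside
    [[0, 1]]. *)
Definition clamp (s : R) : R := Num.max 0 (Num.min s 1).

Lemma clamp_continuous : continuous clamp.
Proof.
apply: continuous_maxr; first exact: cst_continuous.
apply: continuous_minr; [exact: continuous_id|exact: cst_continuous].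
Qed.

Lemma clamp_ge0 s : 0 <= clamp s.
Proof. by rewrite /clamp le_max lexx. Qed.

Lemma clamp_le1 s : clamp s <= 1.
Proof. by rewrite /clamp ge_max ler01 ge_min lexx orbT. Qed.

Lemma clamp_le0 s : s <= 0 -> clamp s = 0.
Proof. by move=> s0; apply/max_idPl; rewrite ge_min s0. Qed.

Lemma clamp_ge1 s : 1 <= s -> clamp s = 1.
Proof. by move=> s1; rewrite /clamp (min_idPr s1); exact/max_idPr/ler01. Qed.

Lemma clamp_id s : 0 <= s -> s <= 1 -> clamp s = s.
Proof. by move=> s0 s1; rewrite /clamp (min_idPl s1); exact/max_idPr. Qed.

Lemma clampK s : clamp (clamp s) = clamp s.
Proof. by apply: clamp_id; [exact: clamp_ge0|exact: clamp_le1]. Qed.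

End Clamp.

Section SimplexRetraction.
Variables (R : realType) (n : nat).
Notation simplex := (std_simplex R n).
Implicit Types (t : simplex) (s : R).

(* Projection of the prism [simplex * [0, 1]] from the point (barycenter, 2): the point
   (t, s) is sent to (b + l (t - b), 2 + l (s - 2)) with 1 / l = [prism_scale t s]. *)
Definition prism_scale t s : R :=
  Num.max (1 - clamp s / 2) (\big[Num.max/0]_i (1 - n.+1%:R * bary t i)).

Lemma prism_scale_ge t s i : 1 - n.+1%:R * bary t i <= prism_scale t s.
Proof.
rewrite /prism_scale le_max; apply/orP; right.
by rewrite (bigD1 i) //= le_max lexx.
Qed.

Lemma prism_scale_ge_time t s : 1 - clamp s / 2 <= prism_scale t s.
Proof. by rewrite /prism_scale le_max lexx. Qed.

Lemma prism_scale_gt0 t s : 0 < prism_scale t s.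
Proof.
apply: lt_le_trans (prism_scale_ge_time t s).
by have := clamp_le1 s; lra.
Qed.

Lemma prism_scale_attained t s :
  prism_scale t s = 1 - clamp s / 2 \/
  exists i, prism_scale t s = 1 - n.+1%:R * bary t i.
Proof.
have := prism_scale_gt0 t s; rewrite /prism_scale.
case: (leP (1 - clamp s / 2)) => [le M0|]; [right|by left].
have : \big[Num.max/0]_i (1 - n.+1%:R * bary t i) = 0 \/
  exists i, \big[Num.max/0]_i (1 - n.+1%:R * bary t i) = 1 - n.+1%:R * bary t i.
  elim/big_ind: _ => [|x y|i _]; [by left| |by right; exists i].
  by case: leP.
by case=> // M0'; rewrite M0' ltxx in M0.
Qed.

Lemma prism_scale_le1 t s : prism_scale t s <= 1.
Proof.
rewrite /prism_scale ge_max; apply/andP; split.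
  by have := clamp_ge0 s; lra.
elim/big_ind: _ => [|x y x1 y1|i _]; [exact: ler01|by rewrite ge_max x1|].
by rewrite lerBlDr lerDl mulr_ge0 // bary_ge0.
Qed.

Lemma prism_scale_face t s i : bary t i = 0 -> prism_scale t s = 1.
Proof.
move=> ti; apply/le_anti; rewrite prism_scale_le1 /=.
by have := prism_scale_ge t s i; rewrite ti mulr0 subr0.
Qed.

Lemma prism_scale_start t : prism_scale t 0 = 1.
Proof.
apply/le_anti; rewrite prism_scale_le1 /=.
by have := prism_scale_ge_time t 0; rewrite clamp_le0 // mul0r subr0.
Qed.

Lemma prism_scale_clamp t s : prism_scale t (clamp s) = prism_scale t s.
Proof. by rewrite /prism_scale clampK. Qed.

Lemma prism_scale_continuous :
  continuous (fun q : simplex * R => prism_scale q.1 q.2).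
Proof.
apply: continuous_maxr.
  apply: continuous_add; first exact: cst_continuous.
  apply: continuous_opp; apply: continuous_mul; last exact: cst_continuous.
  exact: (continuous_comp_fun (@clamp_continuous R) (@continuous_snd _ _)).
apply: (continuous_big max_continuous) => i _.
apply: continuous_add; first exact: cst_continuous.
apply: continuous_opp; apply: continuous_mul; first exact: cst_continuous.
exact: (continuous_comp_fun (@continuous_bary R n i) (@continuous_fst _ _)).
Qed.

(** Coordinate [i] of [b + l (t - b)], that is [1 / n.+1 + l (bary t i - 1 / n.+1)], over a common
    denominator. *)
Definition prism_coord t s i : R :=
  (prism_scale t s - (1 - n.+1%:R * bary t i)) / (n.+1%:R * prism_scale t s).

Lemma prism_coord_ge0 t s i : 0 <= prism_coord t s i.
Proof.
by rewrite divr_ge0 ?subr_ge0 ?prism_scale_ge // mulr_ge0 // ltW // prism_scale_gt0.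
Qed.

Lemma prism_coord_sum t s : \sum_i prism_coord t s i = 1.
Proof.
rewrite -mulr_suml sumrB sumrB -mulr_sumr bary_sum mulr1 !sumr_const card_ord.
rewrite subrr subr0 -[X in X / _]mulr_natl divff //.
by apply: mulf_neq0; rewrite ?pnatr_eq0 // gt_eqF // prism_scale_gt0.
Qed.

Definition prism_simplex t s : simplex :=
  mk_simplex (prism_coord_ge0 t s) (prism_coord_sum t s).

Definition prism_time t s : R := 2 - (2 - clamp s) / prism_scale t s.

Lemma prism_simplex_continuous :
  continuous (fun q : simplex * R => prism_simplex q.1 q.2).
Proof.
apply: continuous_simplex => i.
rewrite (_ : (fun x => _) = (fun q => prism_coord q.1 q.2 i)); last first.
  by apply/funext => q; rewrite mk_simplexE.
apply: continuous_mul.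
  apply: continuous_add; first exact: prism_scale_continuous.
  apply: continuous_opp; apply: continuous_add; first exact: cst_continuous.
  apply: continuous_opp; apply: continuous_mul; first exact: cst_continuous.
  exact: (continuous_comp_fun (@continuous_bary R n i) (@continuous_fst _ _)).
apply: continuous_inv => [q|].
  by apply: mulf_neq0; rewrite ?pnatr_eq0 // gt_eqF // prism_scale_gt0.
by apply: continuous_mul; [exact: cst_continuous|exact: prism_scale_continuous].
Qed.

Lemma prism_time_continuous :
  continuous (fun q : simplex * R => prism_time q.1 q.2).
Proof.
apply: continuous_add; first exact: cst_continuous.
apply: continuous_opp; apply: continuous_mul.
  apply: continuous_add; first exact: cst_continuous.
  apply: continuous_opp.
  exact: (continuous_comp_fun (@clamp_continuous R) (@continuous_snd _ _)).
apply: continuous_inv => [q|]; first by rewrite gt_eqF // prism_scale_gt0.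
exact: prism_scale_continuous.
Qed.

Lemma prism_scale1 t s : prism_scale t s = 1 ->
  prism_simplex t s = t /\ prism_time t s = clamp s.
Proof.
move=> M1; rewrite /prism_time M1; split; last by lra.
apply: bary_inj => i; rewrite mk_simplexE /prism_coord M1 mulr1 opprB addrC subrK.
by rewrite mulrAC divff ?mul1r // pnatr_eq0.
Qed.

Lemma prism_face t s i : bary t i = 0 ->
  prism_simplex t s = t /\ prism_time t s = clamp s.
Proof. by move/prism_scale_face => M1; exact: prism_scale1. Qed.

Lemma prism_start t : prism_simplex t 0 = t /\ prism_time t 0 = 0.
Proof.
by have := prism_scale1 (prism_scale_start t); rewrite (@clamp_le0 _ 0).
Qed.

Lemma prism_clamp t s :
  prism_simplex t (clamp s) = prism_simplex t s /\
  prism_time t (clamp s) = prism_time t s.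
Proof.
rewrite /prism_time clampK prism_scale_clamp; split=> //.
by apply: bary_inj => i; rewrite !mk_simplexE /prism_coord prism_scale_clamp.
Qed.

(** The ray leaves the prism where the maximum in [prism_scale] is attained: its time entry
    corresponds to the bottom, the others to the sides. *)
Lemma prism_cover t s :
  prism_time t s = 0 \/ exists i, bary (prism_simplex t s) i = 0.
Proof.
have M0 := prism_scale_gt0 t s.
case: (prism_scale_attained t s) => [e|[i e]]; [left|right; exists i].
  have nz : 1 - clamp s / 2 != 0 by rewrite -e gt_eqF.
  rewrite /prism_time e (_ : 2 - clamp s = 2 * (1 - clamp s / 2)); last by lra.
  by rewrite mulfK // subrr.
by rewrite mk_simplexE /prism_coord -e subrr mul0r.
Qed.
End SimplexRetraction.

(** * Homotopy extension for realizations of injections *)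

(** A monotone surjection satisfies [f k <= k] by induction upwards from 0, and [k <= f k] by
    induction downwards from [n]. *)
Lemma dhom_surj_id n (f : dhom n n) : (forall j, exists k, f k = j) -> f = did n.
Proof.
move=> fs; apply: dhom_ext => i; rewrite mk_dhomE; apply: val_inj.
apply/eqP; rewrite eqn_leq; apply/andP; split.
- case: i; elim=> [|k IH] ltk.
    have [j fj] := fs (Ordinal ltk).
    by have := dhomP f (leq0n j : (Ordinal ltk <= j)%N); rewrite fj.
  have [j fj] := fs (Ordinal ltk).
  have [jk|kj] := leqP j k; last first.
    by have := dhomP f (kj : (Ordinal ltk <= j)%N); rewrite fj.
  have := dhomP f (jk : (j <= Ordinal (ltnW ltk))%N); rewrite fj /=.
  by have := IH (ltnW ltk); rewrite /=; lia.
- case: i => k; move e : (n - k)%N => d; elim: d k e => [|d IH] k e ltk.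
    have [j fj] := fs (Ordinal ltk).
    have jk : (j <= Ordinal ltk)%N by have := ltn_ord j; rewrite /=; lia.
    by have := dhomP f jk; rewrite fj.
  have ltk1 : (k.+1 < n.+1)%N by lia.
  have [j fj] := fs (Ordinal ltk).
  have [jk|kj] := leqP j k.
    by have := dhomP f (jk : (j <= Ordinal ltk)%N); rewrite fj.
  have := dhomP f (kj : (Ordinal ltk1 <= j)%N); rewrite fj /=.
  by have := IH k.+1 _ ltk1; rewrite /=; lia.
Qed.

(** Every choice of preimages is monotone, so the preimage of [f i] may be prescribed. *)
Lemma dhom_section m n (f : dhom m n) (i : 'I_m.+1) :
  (forall j, exists k, f k = j) ->
  exists g : dhom n m, g (f i) = i /\ dcomp f g = did n.
Proof.
move=> fs; pose g j := if j == f i then i else projT1 (cid (fs j)).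
have fg j : f (g j) = j by rewrite /g; case: eqP => // _; case: cid.
have gm (j j' : 'I_n.+1) : (j <= j')%N -> (g j <= g j')%N.
  move=> jj'; have [->//|ne] := eqVneq j j'.
  rewrite leqNgt; apply/negP => /ltnW /(dhomP f); rewrite !fg => j'j.
  by case/negP: ne; apply/eqP/val_inj; apply/eqP; rewrite eqn_leq jj'.
exists (mk_dhom gm); split; first by rewrite mk_dhomE /g eqxx.
by apply: dhom_ext => j; rewrite !mk_dhomE fg.
Qed.

(** In dimension 0 there is no neighbour to move to, and the identity is a filler; no coordinate of
    a point vanishes there. *)
Definition avoidance n : 'I_n.+1 -> dhom n n :=
  match n with 0 => fun=> did 0 | _ => @avoid _ end.

Lemma avoidance_map m n (f : dhom m n) (j : 'I_n.+1) :
  ~ (exists k, f k = j) -> dcomp (avoidance j) f = f.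
Proof.
case: n f j => [|n] f j nf; apply: dhom_ext => k; rewrite mk_dhomE.
  by rewrite [LHS]ord1 [RHS]ord1.
by apply: avoid_fix; apply/eqP => e; apply: nf; exists k.
Qed.

Section CellAttachment.
Variables (R : realType) (A B : sset) (i : smap A B).
Variables (T P : topologicalType).
Notation simplex := (std_simplex R).
Hypotheses (lP : locally_compact [set: P]) (hP : hausdorff_space P).
Hypothesis i_inj : sinjective i.
Variables (F : realization R B * P -> T) (h : (realization R A * P) * R -> T).
Hypotheses (cF : continuous F) (ch : continuous h).
Hypothesis hF : forall a p, h ((a, p), 0) = F (realization_map i a, p).

(* A subcomplex [C] of [B] with a cellwise extension of the homotopy to [C]. *)
Definition partial_ext : Type :=
  ((forall n, B n -> Prop) * (forall n, B n -> simplex n -> P -> R -> T))%type.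

(** Outside the subcomplex the values of [e.2] are arbitrary. [ext_clamp] is kept because the prism
    retraction returns clamped times on the sides, where new values must match old ones. *)
Record valid_ext (e : partial_ext) : Prop := ValidExt {
  ext_act : forall m n (f : dhom m n) x, e.1 n x -> e.1 m (act f x);
  ext_base : forall n (a : A n), e.1 n (i n a);
  ext_compat : forall m n (f : dhom m n) x t p s, e.1 n x ->
    e.2 m (act f x) t p s = e.2 n x (simplex_map f t) p s;
  ext_cont : forall n x, e.1 n x ->
    continuous (fun q : simplex n * (P * R) => e.2 n x q.1 q.2.1 q.2.2);
  ext_start : forall n x t p, e.1 n x -> e.2 n x t p 0 = F (real_pt x t, p);
  ext_old : forall n (a : A n) t p s,
    e.2 n (i n a) t p s = h ((real_pt a t, p), clamp s);
  ext_clamp : forall n x t p s, e.1 n x -> e.2 n x t p (clamp s) = e.2 n x t p s }.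

Definition ext_le (e e' : partial_ext) : Prop :=
  forall n x, e.1 n x -> e'.1 n x /\ e.2 n x = e'.2 n x.

(** The simplex [x] itself may lie outside the subcomplex, so the two simplices cannot be compared
    through it; a common refinement of [t] and [t'] compares them from below. *)
Lemma ext_uniq e m n k x (f : dhom m k) (g : dhom n k) t t' p s : valid_ext e ->
  e.1 m (act f x) -> e.1 n (act g x) -> simplex_map f t = simplex_map g t' ->
  e.2 m (act f x) t p s = e.2 n (act g x) t' p s.
Proof.
move=> ve Cf Cg; have [r [a [b [v [v0 <- <-]]]]] := common_refinement t t'.
rewrite -!simplex_map_comp => /(simplex_map_positive_inj v0) fg.
by rewrite -!(ext_compat ve) // -!act_comp fg.
Qed.

(** * Attaching one missing simplex of least dimension *)

Section Attach.
Variables (e : partial_ext) (ve : valid_ext e) (n : nat) (x : B n).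
Hypotheses (nx : ~ e.1 n x) (min_n : forall m (y : B m), (m < n)%N -> e.1 m y).

(** In positive dimension [avoidance j] factors through a face of [x], which has smaller dimension
    and is already present. In dimension 0 the only coordinate is 1 and cannot vanish. *)
Lemma avoidance_ext (t : simplex n) j : bary t j = 0 -> e.1 n (act (avoidance j) x).
Proof.
case: n x min_n t j => [|k] y mink t j tj.
  have j0 : j = ord0 by exact: ord1.
  have := bary_sum t; rewrite big_ord_recl big_ord0 -j0 tj addr0 => /eqP.
  by rewrite eq_sym oner_eq0.
by rewrite /= act_comp; apply: (ext_act ve); exact: mink.
Qed.

Lemma avoidance_fix (t : simplex n) j : bary t j = 0 ->
  simplex_map (avoidance j) t = t.
Proof.
case: n t j => [|k] t j tj; last exact: simplex_map_avoid.
exact: simplex_map_id.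
Qed.

Lemma not_surj_ext m (f : dhom m n) : ~ e.1 m (act f x) -> forall j, exists k, f k = j.
Proof.
move=> nf j; apply: contrapT => nj; apply: nf.
rewrite -(avoidance_map nj) act_comp; apply: (ext_act ve).
(* A vertex of the [m]-simplex: its image under [f] has vanishing coordinate [j], as [avoidance_ext]
   requires. *)
have v1 : \sum_(k < m.+1) ((k == ord0)%:R : R) = 1.
  by rewrite (bigD1 ord0) //= big1 ?addr0 // => k /negbTE ->.
have v0 (k : 'I_m.+1) : 0 <= ((k == ord0)%:R : R) by exact: ler0n.
apply: (@avoidance_ext (simplex_map f (mk_simplex v0 v1))).
rewrite bary_map big_pred0 // => k; apply/negP => /eqP fk.
by apply: nj; exists k.
Qed.

Lemma surj_not_ext m (f : dhom m n) : (forall j, exists k, f k = j) ->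
  ~ e.1 m (act f x).
Proof.
move=> fs Cf; have [g [_ fg]] := dhom_section ord0 fs.
by apply: nx; rewrite -(act_id x) -fg act_comp; exact: (ext_act ve).
Qed.

(** Uniqueness as in the Eilenberg-Zilber lemma. A section [s] of the surjection [f] gives
    [act (dcomp g s) x = x], which forces [dcomp g s] to be the identity; sections through every
    vertex then determine [g]. *)
Lemma new_simplex_inj m (f g : dhom m n) :
  ~ e.1 m (act f x) -> act f x = act g x -> f = g.
Proof.
move=> nf fg; have fs := not_surj_ext nf; apply: dhom_ext => k.
have [s [sk fsid]] := dhom_section k fs.
have gs : dcomp g s = did n.
  apply/dhom_surj_id/not_surj_ext.
  by rewrite act_comp -fg -act_comp fsid act_id.
by rewrite -{2}sk; have := congr1 (fun d : dhom n n => d (f k)) gs; rewrite !mk_dhomE.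
Qed.

(** The prism retraction, followed by [F] on the bottom and by the old extension on the sides; the
    last branch is never reached, by [prism_cover]. Side [j] is represented by the [n]-simplex
    [act (avoidance j) x], which spares a change of coordinates. *)
Definition new_cell (t : simplex n) (p : P) (s : R) : T :=
  if pselect (prism_time t s = 0) then F (real_pt x (prism_simplex t s), p)
  else if [pick j | bary (prism_simplex t s) j == 0] is Some j then
    e.2 n (act (avoidance j) x) (prism_simplex t s) p (prism_time t s)
  else F (real_pt x t, p).

Lemma new_cell_bottom t p s : prism_time t s = 0 ->
  new_cell t p s = F (real_pt x (prism_simplex t s), p).
Proof. by rewrite /new_cell; case: pselect. Qed.

(** The pieces agree on overlaps: at time 0 the old extension starts at [F], and two sides through
    the same point agree by [ext_uniq]. *)
Lemma new_cell_side t p s j : bary (prism_simplex t s) j = 0 ->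
  new_cell t p s = e.2 n (act (avoidance j) x) (prism_simplex t s) p (prism_time t s).
Proof.
move=> tj; have Cj := avoidance_ext tj.
rewrite /new_cell; case: pselect => [/= ->|_ /=].
  by rewrite (ext_start ve) // real_pt_act avoidance_fix.
case: pickP => [k /eqP tk|/(_ j)]; last by rewrite tj eqxx.
apply: (ext_uniq _ _ ve) => //; first exact: avoidance_ext tk.
by rewrite !avoidance_fix.
Qed.

Lemma new_cell_continuous :
  continuous (fun q : simplex n * (P * R) => new_cell q.1 q.2.1 q.2.2).
Proof.
have c2 : continuous (fun q : simplex n * (P * R) => q.2.2).
  exact: (continuous_comp_fun (@continuous_snd _ _) (@continuous_snd _ _)).
have c1 : continuous (fun q : simplex n * (P * R) => q.2.1).
  exact: (continuous_comp_fun (@continuous_fst _ _) (@continuous_snd _ _)).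
have cq : continuous (fun q : simplex n * (P * R) => (q.1, q.2.2)).
  by apply: continuous_pair => //; exact: continuous_fst.
have cs := continuous_comp_fun (@prism_simplex_continuous R n) cq.
have ct := continuous_comp_fun (@prism_time_continuous R n) cq.
apply: (@continuous_paste (option 'I_n.+1) _ _ _
  (fun o q => match o with None => prism_time q.1 q.2.2 = 0
     | Some j => bary (prism_simplex q.1 q.2.2) j = 0 end)
  (fun o q => match o with None => F (real_pt x (prism_simplex q.1 q.2.2), q.2.1)
     | Some j => e.2 n (act (avoidance j) x) (prism_simplex q.1 q.2.2) q.2.1
         (prism_time q.1 q.2.2) end)).
- move=> [j|].
    apply: (@preimage_closed _ _
      (fun q : simplex n * (P * R) => bary (prism_simplex q.1 q.2.2) j) [set 0]).
      by move=> q _; exact: (continuous_comp_fun (@continuous_bary R n j) cs).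
    exact: closed_eq.
  apply: (@preimage_closed _ _
      (fun q : simplex n * (P * R) => prism_time q.1 q.2.2) [set 0]).
    by move=> q _; exact: ct.
  exact: closed_eq.
- move=> [j|] q.
    move=> /avoidance_ext /(ext_cont ve) ce.
    have cz := continuous_pair cs (continuous_pair c1 ct).
    exact: (continuous_comp_fun ce cz).
  move=> _; apply: (continuous_comp_fun cF); apply: continuous_pair => //.
  exact: (continuous_comp_fun (@continuous_real_pt R B n x) cs).
- by move=> [j|] q; [exact: new_cell_side|exact: new_cell_bottom].
- move=> q; have [t0|[j tj]] := prism_cover q.1 q.2.2; first by exists None.
  by exists (Some j).
Qed.

Definition attach : partial_ext :=
  (fun m y => e.1 m y \/ exists f : dhom m n, y = act f x,
   fun m y t p s => if pselect (e.1 m y) then e.2 m y t p s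
     else if pselect (exists f : dhom m n, y = act f x) is left H
     then new_cell (simplex_map (projT1 (cid H)) t) p s
     else F (real_pt y t, p)).

Lemma attach_old m y : e.1 m y -> attach.2 m y = e.2 m y.
Proof.
by move=> Cy; apply/funext => t; apply/funext => p; apply/funext => s /=; case: pselect.
Qed.

Lemma attach_new m (f : dhom m n) t p s : ~ e.1 m (act f x) ->
  attach.2 m (act f x) t p s = new_cell (simplex_map f t) p s.
Proof.
move=> nf /=; case: pselect => [/nf //|? /=]; case: pselect => [H|[]]; last by exists f.
by case: cid => g /= fg; rewrite (new_simplex_inj nf fg).
Qed.

Lemma attach_valid : valid_ext attach.
Proof.
split.
- move=> m k f y [Cy|[g ->]]; first by left; exact: (ext_act ve).
  by right; exists (dcomp g f); rewrite act_comp.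
- by move=> m a; left; exact: (ext_base ve).
- move=> m k f y t p s Cy; have [Cy'|nCy] := pselect (e.1 k y).
    by rewrite !attach_old ?(ext_compat ve) //; exact: (ext_act ve).
  case: Cy => // -[g yg]; subst y; rewrite (attach_new _ _ _ nCy) -act_comp.
  have [Cgf|nCgf] := pselect (e.1 m (act (dcomp g f) x)); last first.
    by rewrite attach_new // simplex_map_comp.
  rewrite attach_old // -simplex_map_comp.
  (* An old simplex of this form misses a vertex [j]; its points lie on side [j], which the prism
     retraction fixes up to clamping of time. *)
  have [j nj] : exists j, ~ exists k, dcomp g f k = j.
    by apply/existsNP => /surj_not_ext /(_ Cgf).
  have tj : bary (simplex_map (dcomp g f) t) j = 0.
    by rewrite bary_map big_pred0 // => l; apply/negP => /eqP fl; apply: nj; exists l.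
  have [et es] := prism_face s tj.
  rewrite (@new_cell_side _ _ _ j) ?et // es (ext_clamp ve); last exact: avoidance_ext tj.
  apply: (ext_uniq _ _ ve) => //; first exact: avoidance_ext tj.
  by rewrite avoidance_fix.
- move=> m y Cy; have [Cy'|nCy] := pselect (e.1 m y).
    by rewrite attach_old //; exact: (ext_cont ve).
  case: Cy => // -[g yg]; subst y.
  rewrite (_ : (fun q => _) =
      (fun q : simplex m * (P * R) => new_cell (simplex_map g q.1) q.2.1 q.2.2)).
    apply: (@continuous_comp_fun _ _ _ (fun q : simplex n * (P * R) =>
      new_cell q.1 q.2.1 q.2.2) (fun q => (simplex_map g q.1, q.2))).
      exact: new_cell_continuous.
    apply: continuous_pair; last exact: continuous_snd.
    exact: (continuous_comp_fun (@continuous_simplex_map R _ _ g) (@continuous_fst _ _)).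
  by apply/funext => q; rewrite attach_new.
- move=> m y t p Cy; have [Cy'|nCy] := pselect (e.1 m y).
    by rewrite attach_old //; exact: (ext_start ve).
  case: Cy => // -[g yg]; subst y; rewrite attach_new //.
  have [et es] := prism_start (simplex_map g t).
  by rewrite new_cell_bottom // et real_pt_act.
- by move=> m a t p s; rewrite attach_old; [exact: (ext_old ve)|exact: (ext_base ve)].
- move=> m y t p s Cy; have [Cy'|nCy] := pselect (e.1 m y).
    by rewrite attach_old //; exact: (ext_clamp ve).
  case: Cy => // -[g yg]; subst y; rewrite !attach_new //.
  by rewrite /new_cell; have [-> ->] := prism_clamp (simplex_map g t) s.
Qed.

Lemma attach_le : ext_le e attach.
Proof. by move=> m y Cy; split; [left|rewrite attach_old]. Qed.

Lemma attach_mem : attach.1 n x.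
Proof. by right; exists (did n); rewrite act_id. Qed.
End Attach.

Definition initial_ext : partial_ext :=
  (fun n x => exists a, i n a = x,
   fun n x t p s => if pselect (exists a, i n a = x) is left H
     then h ((real_pt (projT1 (cid H)) t, p), clamp s) else F (real_pt x t, p)).

Lemma initial_extE n (a : A n) t p s :
  initial_ext.2 n (i n a) t p s = h ((real_pt a t, p), clamp s).
Proof.
move=> /=; case: pselect => [H|[]]; last by exists a.
by case: cid => a' /= /i_inj ->.
Qed.

Lemma initial_ext_valid : valid_ext initial_ext.
Proof.
split.
- by move=> m n f _ [a <-]; exists (act f a); rewrite sfun_act.
- by move=> n a; exists a.
- move=> m n f _ t p s [a <-]; rewrite -sfun_act !initial_extE.
  by rewrite real_pt_act.
- move=> n _ [a <-]; rewrite (_ : (fun q => _) =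
    (fun q => h ((real_pt a q.1, q.2.1), clamp q.2.2))); last first.
    by apply/funext => q; rewrite initial_extE.
  apply: (continuous_comp_fun ch); apply: continuous_pair.
    apply: continuous_pair.
      exact: (continuous_comp_fun (@continuous_real_pt R A n a) (@continuous_fst _ _)).
    exact: (continuous_comp_fun (@continuous_fst _ _) (@continuous_snd _ _)).
  apply: (continuous_comp_fun (@clamp_continuous R)).
  exact: (continuous_comp_fun (@continuous_snd _ _) (@continuous_snd _ _)).
- move=> n _ t p [a <-]; rewrite initial_extE clamp_le0 // hF.
  by rewrite realization_mapE.
- exact: initial_extE.
- by move=> n _ t p s [a <-]; rewrite !initial_extE clampK.
Qed.

Definition ext_type := {e : partial_ext | valid_ext e}.

Lemma chain_bound (S : set ext_type) :
  total_on S (fun a b => `[< ext_le (sval a) (sval b) >]) ->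
  exists u : ext_type, forall e, S e -> `[< ext_le (sval e) (sval u) >].
Proof.
move=> tot; have [[e0 Se0]|S0] := pselect (exists e, S e); last first.
  exists (exist _ _ initial_ext_valid) => e Se.
  by case: S0; exists e.
pose C n x := exists2 e : ext_type, S e & (sval e).1 n x.
pose phi n x : simplex n -> P -> R -> T :=
  if pselect (C n x) is left H then (sval (s2val (cid2 H))).2 n x
  else fun t p s => F (real_pt x t, p).
have phiE (e : ext_type) n x : S e -> (sval e).1 n x -> phi n x = (sval e).2 n x.
  move=> Se ex; rewrite /phi; case: pselect => [H|[]]; last by exists e.
  case: (cid2 H) => e' Se' e'x /=.
  by have [/asboolP/(_ n x ex)[]|/asboolP/(_ n x e'x)[]] := tot _ _ Se Se'.
have vC : valid_ext (C, phi).
  split=> /=.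
  - move=> m n f x [e Se ex]; exists e => //; exact: (ext_act (svalP e)).
  - move=> n a; exists e0 => //; exact: (ext_base (svalP e0)).
  - move=> m n f x t p s [e Se ex]; rewrite !(phiE e) //.
      exact: (ext_compat (svalP e)).
    exact: (ext_act (svalP e)).
  - by move=> n x [e Se ex]; rewrite (phiE e) //; exact: (ext_cont (svalP e)).
  - by move=> n x t p [e Se ex]; rewrite (phiE e) //; exact: (ext_start (svalP e)).
  - move=> n a t p s; rewrite (phiE e0) //; first exact: (ext_old (svalP e0)).
    exact: (ext_base (svalP e0)).
  - by move=> n x t p s [e Se ex]; rewrite (phiE e) //; exact: (ext_clamp (svalP e)).
exists (exist _ _ vC) => e Se; apply/asboolP => n x ex /=; split; first by exists e.
by rewrite (phiE e).
Qed.

(** A maximal extension that missed a simplex could be enlarged by one of least dimension, all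
    simplices of lower dimension being present; such a simplex is automatically nondegenerate. *)
Lemma total_ext : exists2 e, valid_ext e & forall n x, e.1 n x.
Proof.
have [||u umax] := ZL_preorder (exist _ _ initial_ext_valid : ext_type) _ _ chain_bound.
- by move=> e; apply/asboolP => n x.
- move=> a b c /asboolP ba /asboolP ac; apply/asboolP => n x /ba[ax ->].
  by have [cx ->] := ac n x ax.
exists (sval u); first exact: svalP.
apply: contrapT => /existsNP Nall.
have exN : exists n, `[< exists x, ~ (sval u).1 n x >].
  by case: Nall => n /existsNP[x nx]; exists n; apply/asboolP; exists x.
case: (ex_minnP exN) => n /asboolP[x nx] minn.
have min_n m (y : B m) : (m < n)%N -> (sval u).1 m y.
  move=> mn; apply: contrapT => ny; have := minn m; rewrite leqNgt mn /=.
  by move=> W; have : false by apply: W; apply/asboolP; exists y.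
pose w : ext_type := exist _ _ (attach_valid (svalP u) nx min_n).
have /umax/asboolP/(_ n x (attach_mem (sval u) x))[] : `[< ext_le (sval u) (sval w) >].
  by apply/asboolP; exact: attach_le.
by [].
Qed.

Lemma homotopy_extension_cells :
  exists H : (realization R B * P) * R -> T,
    [/\ continuous H, forall b p, H ((b, p), 0) = F (b, p) &
        forall a p s, H ((realization_map i a, p), s) = h ((a, p), clamp s)].
Proof.
have [e ve Ce] := total_ext.
pose H q := real_lift (fun n x t p s => e.2 n x t p s) q.1.1 q.1.2 q.2.
have HE n (x : B n) t p s : H ((real_pt x t, p), s) = e.2 n x t p s.
  rewrite /H /= real_liftE // => m k f y r.
  by apply/funext => p'; apply/funext => s'; rewrite (ext_compat ve).
exists H; split.
(* Reassociation: the quotient map is multiplied by the single parameter space [P * R]. *)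
- pose H' (q : realization R B * (P * R)) := H ((q.1, q.2.1), q.2.2).
  rewrite (_ : H = fun q => H' (q.1.1, (q.1.2, q.2))); last first.
    by apply/funext => -[[]].
  apply: (@continuous_comp_fun _ _ _ H' (fun q => (q.1.1, (q.1.2, q.2)))).
    apply: real_prod_continuous => [||n x].
    + by apply: locally_compact_prod => //; exact: locally_compactR.
    + by apply: hausdorff_prod => //; exact: Rhausdorff.
    rewrite (_ : (fun q => _) = (fun q => e.2 n x q.1 q.2.1 q.2.2)).
      exact: (ext_cont ve).
    by apply/funext => q; rewrite /H' /= HE.
  apply: continuous_pair.
    exact: (continuous_comp_fun (@continuous_fst _ _) (@continuous_fst _ _)).
  apply: continuous_pair; last exact: continuous_snd.
  exact: (continuous_comp_fun (@continuous_snd _ _) (@continuous_fst _ _)).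
- by move=> b p; elim/real_ind: b => n x t; rewrite HE (ext_start ve).
- by move=> a p s; elim/real_ind: a => n x t; rewrite realization_mapE HE (ext_old ve).
Qed.
End CellAttachment.

(** * Homotopy equivalences and strong deformation retracts *)

Section Homotopy.
Variable R : realType.
Implicit Types A B C : topologicalType.

Definition homot A B (f g : A -> B) : Prop :=
  exists H : A * R -> B,
    [/\ continuous H, forall a, H (a, 0) = f a & forall a, H (a, 1) = g a].

(** Precomposition with [clamp] in the time variable turns continuity within the strip [A x [0, 1]]
    into plain continuity. *)
Lemma homotopicP A B (f g : A -> B) : homotopic R f g <-> homot f g.
Proof.
split=> [[H [cH H0 H1]]|[H [cH H0 H1]]]; last first.
  by exists H; split=> //; exact: continuous_subspaceT.
have cc : continuous (fun q : A * R => (q.1, clamp q.2)).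
  apply: continuous_pair; first exact: continuous_fst.
  exact: (continuous_comp_fun (@clamp_continuous R) (@continuous_snd _ _)).
have Dc (q : A * R) : (setT `*` `[0, 1]) (q.1, clamp q.2).
  by split=> //=; rewrite in_itv /= clamp_ge0 clamp_le1.
exists (fun q => H (q.1, clamp q.2)); split=> [q U nU|a|a] /=.
- have := cH (q.1, clamp q.2) U nU; rewrite nbhs_filterE /fmap /=.
  rewrite {1}/nbhs /= -nbhs_subspace_in; last exact: Dc.
  rewrite /within /= => nW.
  have := cc q _ nW; rewrite !nbhs_filterE /fmap /=; apply: filterS => z.
  exact: (fun W => W (Dc z)).
- by rewrite clamp_le0.
- by rewrite clamp_ge1.
Qed.

Lemma paste_half A B (f g : A * R -> B) : continuous f -> continuous g ->
  (forall a, f (a, 1 / 2) = g (a, 1 / 2)) ->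
  continuous (fun q : A * R => if q.2 <= 1 / 2 then f q else g q).
Proof.
move=> cf cg fg.
apply: (@continuous_paste bool _ _ _
  (fun b (q : A * R) => if b then q.2 <= 1 / 2 else 1 / 2 <= q.2)
  (fun b => if b then f else g)).
- case.
    apply: (@preimage_closed _ _ snd [set s : R | s <= 1 / 2]); last exact: closed_le.
    by move=> q _; exact: continuous_snd.
  apply: (@preimage_closed _ _ snd [set s : R | 1 / 2 <= s]); last exact: closed_ge.
  by move=> q _; exact: continuous_snd.
- by case.
- case=> -[a s] /= h; first by rewrite h.
  case: ifPn => // h'; rewrite (_ : s = 1 / 2); first exact: fg.
  by apply/le_anti; rewrite h h'.
- by move=> q; have [h|/ltW h] := leP q.2 (1 / 2); [exists true|exists false].
Qed.

Lemma homot_refl A B (f : A -> B) : continuous f -> homot f f.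
Proof.
move=> cf; exists (fun q => f q.1); split=> //.
exact: (continuous_comp_fun cf (@continuous_fst _ _)).
Qed.

Lemma continuous_time A (P : topologicalType) (u : A * R -> P) (k : R -> R) :
  continuous k -> continuous u -> continuous (fun q : A * R => u (q.1, k q.2)).
Proof.
move=> ck cu; apply: (@continuous_comp_fun _ _ _ u (fun q => (q.1, k q.2)) cu).
apply: continuous_pair; first exact: continuous_fst.
exact: (continuous_comp_fun ck (@continuous_snd _ _)).
Qed.

(** Time changes below are built from this shape, which explains terms such as [2 * q.2 + 0]. *)
Lemma affine_continuous (a b : R) : continuous (fun s : R => a * s + b).
Proof.
apply: continuous_add; last exact: cst_continuous.
by apply: continuous_mul; [exact: cst_continuous|exact: continuous_id].
Qed.

Lemma homot_sym A B (f g : A -> B) : homot f g -> homot g f.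
Proof.
move=> [H [cH H0 H1]]; exists (fun q => H (q.1, -1 * q.2 + 1)); split=> [|a|a] /=.
- exact: (@continuous_time _ _ H (fun s => -1 * s + 1) (@affine_continuous _ _)).
- by rewrite mulr0 add0r.
- by rewrite mulr1 addNr.
Qed.

Lemma homot_trans A B (f g k : A -> B) : homot f g -> homot g k -> homot f k.
Proof.
move=> [H [cH H0 H1]] [K [cK K0 K1]].
exists (fun q => if q.2 <= 1 / 2 then H (q.1, 2 * q.2 + 0) else K (q.1, 2 * q.2 + -1)).
split=> [|a|a] /=.
- apply: (@paste_half _ _ (fun q => H (q.1, 2 * q.2 + 0)) (fun q => K (q.1, 2 * q.2 + -1))).
  + exact: (@continuous_time _ _ H (fun s => 2 * s + 0) (@affine_continuous _ _)).
  + exact: (@continuous_time _ _ K (fun s => 2 * s + -1) (@affine_continuous _ _)).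
  + move=> a /=; rewrite (_ : 2 * (1 / 2) + 0 = 1) ?H1; last by lra.
    by rewrite (_ : 2 * (1 / 2) + -1 = 0) ?K0; last lra.
- by rewrite ifT ?mulr0 ?addr0 ?H0 //; lra.
- rewrite ifF; last by apply/negbTE; rewrite -ltNge; lra.
  by rewrite (_ : 2 * 1 + -1 = 1) ?K1 //; lra.
Qed.

Lemma homot_comp A B C (f g : A -> B) (k : B -> C) :
  continuous k -> homot f g -> homot (k \o f) (k \o g).
Proof.
move=> ck [H [cH H0 H1]]; exists (k \o H).
by split=> [|a|a] /=; rewrite ?H0 ?H1 //; exact: continuous_comp_fun.
Qed.

Lemma homot_precomp A B C (f g : A -> B) (k : C -> A) :
  continuous k -> homot f g -> homot (f \o k) (g \o k).
Proof.
move=> ck [H [cH H0 H1]]; exists (fun q => H (k q.1, q.2)).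
split=> [|a|a] /=; rewrite ?H0 ?H1 //.
apply: (@continuous_comp_fun _ _ _ H (fun q => (k q.1, q.2)) cH).
apply: continuous_pair; last exact: continuous_snd.
exact: (continuous_comp_fun ck (@continuous_fst _ _)).
Qed.

Definition hequiv A B (f : A -> B) : Prop :=
  continuous f /\ exists g : B -> A,
    [/\ continuous g, homot (g \o f) id & homot (f \o g) id].

Lemma hequivP A B (f : A -> B) : homotopy_equivalence R f <-> hequiv f.
Proof.
by split=> -[cf [g [cg gf fg]]]; split=> //; exists g; split=> //; apply/homotopicP.
Qed.

Lemma hequiv_comp A B C (f : A -> B) (g : B -> C) :
  hequiv f -> hequiv g -> hequiv (g \o f).
Proof.
move=> [cf [f' [cf' f'f ff']]] [cg [g' [cg' g'g gg']]]; split.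
  exact: continuous_comp_fun.
exists (f' \o g'); split; first exact: continuous_comp_fun.
  exact: homot_trans (homot_comp cf' (homot_precomp cf g'g)) f'f.
exact: homot_trans (homot_comp cg (homot_precomp cg' ff')) gg'.
Qed.

Lemma hequiv_cancel_right A B C (f : A -> B) (g : B -> C) :
  continuous g -> hequiv f -> hequiv (g \o f) -> hequiv g.
Proof.
move=> cg [cf [f' [cf' f'f ff']]] [_ [k [ck kgf gfk]]]; split=> //.
exists (f \o k); split=> //; first exact: continuous_comp_fun.
apply: (@homot_trans _ _ _ (f \o (k \o (g \o f)) \o f')).
  exact: (homot_comp (continuous_comp_fun cf (continuous_comp_fun ck cg)) (homot_sym ff')).
exact: homot_trans (homot_comp cf (homot_precomp cf' kgf)) ff'.
Qed.

Lemma hequiv_cancel_left A B C (f : A -> B) (g : B -> C) :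
  continuous f -> hequiv g -> hequiv (g \o f) -> hequiv f.
Proof.
move=> cf [cg [g' [cg' g'g gg']]] [_ [k [ck kgf gfk]]]; split=> //.
exists (k \o g); split=> //; first exact: continuous_comp_fun.
apply: (@homot_trans _ _ _ (g' \o ((g \o f) \o k) \o g)).
  exact: (homot_precomp (continuous_comp_fun cf (continuous_comp_fun ck cg)) (homot_sym g'g)).
exact: homot_trans (homot_comp cg' (homot_precomp cg gfk)) g'g.
Qed.

Definition strong_retract A B (i : A -> B) : Prop :=
  exists (g : B -> A) (D : B * R -> B),
    [/\ continuous g /\ continuous D, forall a, g (i a) = a,
        forall b, D (b, 0) = b, forall b, D (b, 1) = i (g b) &
        forall a s, D (i a, s) = i a].

Lemma strong_retract_hequiv A B (i : A -> B) :
  continuous i -> strong_retract i -> hequiv i.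
Proof.
move=> ci [g [D [[cg cD] gi D0 D1 Di]]]; split=> //; exists g; split=> //.
  rewrite (_ : g \o i = id); first exact: homot_refl (@continuous_id _).
  by apply/funext.
by apply: homot_sym; exists D.
Qed.

(* The extension property allows a parameter in [R]. *)
Definition homotopy_extension A B (i : A -> B) : Prop :=
  forall (T : topologicalType) (F : B * R -> T) (h : (A * R) * R -> T),
    continuous F -> continuous h -> (forall a p, h ((a, p), 0) = F (i a, p)) ->
    exists H : (B * R) * R -> T,
      [/\ continuous H, forall b p, H ((b, p), 0) = F (b, p) &
          forall a p s, H ((i a, p), s) = h ((a, p), clamp s)].

(** Homotopy extension deforms the inverse [g] along the homotopy from [g \o i] to the identity; at
    the end of the deformation the equation on [A] is strict. *)
Lemma hequiv_retraction A B (i : A -> B) : homotopy_extension i -> hequiv i ->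
  exists g : B -> A, [/\ continuous g, forall a, g (i a) = a & homot id (i \o g)].
Proof.
move=> hep [ci [g [cg gi ig]]]; have [al [cal al0 al1]] := gi.
have [|||H [cH H0 Hi]] := hep A (fun q => g q.1) (fun q => al (q.1.1, q.2)).
- exact: (continuous_comp_fun cg (@continuous_fst _ _)).
- apply: (@continuous_comp_fun _ _ _ al (fun q : A * R * R => (q.1.1, q.2)) cal).
  apply: continuous_pair; last exact: continuous_snd.
  exact: (continuous_comp_fun (@continuous_fst _ _) (@continuous_fst _ _)).
- by move=> a _ /=; rewrite al0.
have cc (s : R) : continuous (fun b : B => H ((b, 0), s)).
  apply: (@continuous_comp_fun _ _ _ H (fun b => ((b, 0), s)) cH).
  apply: continuous_pair; last exact: cst_continuous.
  by apply: continuous_pair; [exact: continuous_id|exact: cst_continuous].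
exists (fun b => H ((b, 0), 1)); split=> [//|a|]; first by rewrite Hi clamp_ge1 //= al1.
apply: homot_trans (homot_sym ig) (homot_comp ci _).
exists (fun q => H ((q.1, 0), q.2)); split=> //.
apply: (@continuous_comp_fun _ _ _ H (fun q : B * R => ((q.1, 0), q.2)) cH).
apply: continuous_pair; last exact: continuous_snd.
by apply: continuous_pair; [exact: continuous_fst|exact: cst_continuous].
Qed.

(* If [G] is a homotopy from the identity to [i g], with [g] a retraction, then running
   [G] after [i g] and then backwards gives a homotopy from [i g] to the identity whose
   restriction to [A] is a path followed by its inverse. That restriction is contracted
   relative to its ends, the contraction is extended to [B], and the homotopy relative to
   [A] is read off the three other sides of the resulting square. *)
Lemma hequiv_strong_retract A B (i : A -> B) :
  homotopy_extension i -> hequiv i -> strong_retract i.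
Proof.
move=> hep hi; have [g [cg gi [G [cG G0 G1]]]] := hequiv_retraction hep hi.
have [ci _] := hi.
have cig : continuous (i \o g) by exact: continuous_comp_fun.
pose L (q : B * R) :=
  if q.2 <= 1 / 2 then G (i (g q.1), 2 * q.2 + 0) else G (q.1, -2 * q.2 + 2).
have cL : continuous L.
  apply: (@paste_half _ _ (fun q => G (i (g q.1), 2 * q.2 + 0))
    (fun q => G (q.1, -2 * q.2 + 2))).
  - apply: (@continuous_time _ _ (fun q => G (i (g q.1), q.2)) (fun s => 2 * s + 0)).
      exact: affine_continuous.
    apply: (@continuous_comp_fun _ _ _ G (fun q : B * R => (i (g q.1), q.2)) cG).
    apply: continuous_pair; last exact: continuous_snd.
    exact: (continuous_comp_fun cig (@continuous_fst _ _)).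
  - exact: (@continuous_time _ _ G (fun s => -2 * s + 2) (@affine_continuous _ _)).
  - move=> b /=; rewrite (_ : 2 * (1 / 2) + 0 = 1) ?G1; last by lra.
    by rewrite (_ : -2 * (1 / 2) + 2 = 1) ?G1 /= ?gi //; lra.
(* With [p = q.1.2] and [s = q.2], the factor [min (2 p) (2 - 2 p)] follows [L] on [A], out along
   [G] and back; multiplying by [1 - s] shrinks this path to its starting point. *)
pose M (q : (A * R) * R) :=
  G (i q.1.1, Num.min (2 * q.1.2 + 0) (-2 * q.1.2 + 2) * (-1 * q.2 + 1)).
have c12 : continuous (fun q : (A * R) * R => q.1.2).
  exact: (continuous_comp_fun (@continuous_snd _ _) (@continuous_fst _ _)).
have cM : continuous M.
  apply: (@continuous_comp_fun _ _ _ G (fun q : A * R * R => (i q.1.1, _)) cG).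
  apply: continuous_pair.
    apply: (continuous_comp_fun ci).
    exact: (continuous_comp_fun (@continuous_fst _ _) (@continuous_fst _ _)).
  apply: continuous_mul.
    by apply: continuous_minr;
      exact: (continuous_comp_fun (@affine_continuous _ _) c12).
  exact: (continuous_comp_fun (@affine_continuous _ _) (@continuous_snd _ _)).
have [||a p /=|H [cH H0 Hi]] := hep B L M => //.
  rewrite /M /L /= mulr0 add0r mulr1 gi; case: leP => le.
    by rewrite min_l //; lra.
  by rewrite min_r //; lra.
(* As [r] runs through the thirds of [[0, 1]], the point [(c1 r, c2 r)] passes through [(1, 0)],
   [(1, 1)], [(0, 1)], [(0, 0)]; on these three sides [M] is constantly [i a]. *)
pose c1 r : R := clamp (-3 * r + 2).
pose c2 r : R := clamp (Num.min (3 * r + 0) (-3 * r + 3)).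
have cc1 : continuous c1.
  exact: (continuous_comp_fun (@clamp_continuous R) (@affine_continuous _ _)).
have cc2 : continuous c2.
  apply: (continuous_comp_fun (@clamp_continuous R)).
  by apply: continuous_minr; exact: affine_continuous.
have c01 r : c1 r = 0 \/ c1 r = 1 \/ c2 r = 1.
  have [h|h] := leP r (1 / 3); first by right; left; apply: clamp_ge1; lra.
  have [h'|h'] := leP (2 / 3) r; first by left; apply: clamp_le0; lra.
  by right; right; apply: clamp_ge1; rewrite le_min; apply/andP; split; lra.
have MA a r : M ((a, c1 r), c2 r) = i a.
  rewrite /M /= (_ : _ * _ = 0) ?G0 //.
  case: (c01 r) => [->|[->|->]]; last by rewrite mulr1 addNr mulr0.
    by rewrite mulr0 mulr0 !add0r min_l ?mul0r //; lra.
  by rewrite !mulr1 min_r; [rewrite addNr mul0r|lra].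
exists g, (fun q => H ((q.1, c1 q.2), c2 q.2)); split=> [|//|b|b|a r] /=.
- split=> //.
  apply: (@continuous_comp_fun _ _ _ H (fun q : B * R => ((q.1, c1 q.2), c2 q.2)) cH).
  apply: continuous_pair; last exact: (continuous_comp_fun cc2 (@continuous_snd _ _)).
  apply: continuous_pair; first exact: continuous_fst.
  exact: (continuous_comp_fun cc1 (@continuous_snd _ _)).
- rewrite (_ : c2 0 = 0); last by rewrite /c2 min_l ?clamp_le0 //; lra.
  rewrite (_ : c1 0 = 1); last by apply: clamp_ge1; lra.
  rewrite H0 /L /= ifF; last by apply/negbTE; rewrite -ltNge; lra.
  by rewrite (_ : -2 * 1 + 2 = 0) ?G0 //; lra.
- rewrite (_ : c2 1 = 0); last by rewrite /c2 min_r ?clamp_le0 //; lra.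
  rewrite (_ : c1 1 = 0); last by apply: clamp_le0; lra.
  rewrite H0 /L /= ifT; last by lra.
  by rewrite mulr0 addr0 G0.
- by rewrite Hi /c2 clampK -/(c2 r) MA.
Qed.
End Homotopy.

(** * Levelwise pushouts and simplicial homotopies *)

Section LevelwisePushout.
Variables (A B C D : sset) (f : smap A B) (g : smap A C) (h : smap B D) (k : smap C D).

(** Uniqueness of [w] is left to the second clause, the joint surjectivity of [h] and [k]. [U]
    ranges over all types, so that function types qualify. *)
Definition levelwise_pushout : Prop :=
  [/\ forall n a, h n (f n a) = k n (g n a),
      forall n (d : D n), (exists b, d = h n b) \/ (exists c, d = k n c) &
      forall n (U : Type) (u : B n -> U) (v : C n -> U),
        (forall a, u (f n a) = v (g n a)) ->
        exists w : D n -> U, (forall b, w (h n b) = u b) /\ (forall c, w (k n c) = v c)].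

Variable R : realType.
Hypothesis po : levelwise_pushout.

Lemma real_pushout_surj (z : realization R D) :
  (exists b, z = realization_map h b) \/ (exists c, z = realization_map k c).
Proof.
elim/real_ind: z => n d t; have [_ surj _] := po.
have [[b ->]|[c ->]] := surj n d; [left|right].
  by exists (real_pt b t); rewrite realization_mapE.
by exists (real_pt c t); rewrite realization_mapE.
Qed.

(** Every simplex of [D] comes from [B] or [C], and continuity is tested on single simplices. The
    factor [R] serves homotopies; plain maps are obtained at time 0. *)
Lemma real_pushout (T : topologicalType) (u : realization R B * R -> T)
    (v : realization R C * R -> T) :
  continuous u -> continuous v ->
  (forall a s, u (realization_map f a, s) = v (realization_map g a, s)) ->
  exists w : realization R D * R -> T,
    [/\ continuous w, forall b s, w (realization_map h b, s) = u (b, s) &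
        forall c s, w (realization_map k c, s) = v (c, s)].
Proof.
move=> cu cv uv; have [_ surj elim_po] := po.
have ex n : exists w : D n -> std_simplex R n -> R -> T,
    (forall b, w (h n b) = fun t s => u (real_pt b t, s)) /\
    (forall c, w (k n c) = fun t s => v (real_pt c t, s)).
  apply: elim_po => a; apply/funext => t; apply/funext => s.
  by have := uv (real_pt a t) s; rewrite !realization_mapE.
pose phi n := projT1 (cid (ex n)).
have phih n b : phi n (h n b) = fun t s => u (real_pt b t, s).
  by rewrite /phi; case: cid => w [].
have phik n c : phi n (k n c) = fun t s => v (real_pt c t, s).
  by rewrite /phi; case: cid => w [].
pose w q := real_lift phi q.1 q.2.
have wE n (d : D n) t s : w (real_pt d t, s) = phi n d t s.
  rewrite /w /= real_liftE // => m p e x r; apply/funext => s'.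
  have [[b ->]|[c ->]] := surj p x.
    by rewrite -sfun_act !phih real_pt_act.
  by rewrite -sfun_act !phik real_pt_act.
exists w; split=> [|b s|c s].
- apply: real_prod_continuous => [||n d]; [exact: locally_compactR|exact: Rhausdorff|].
  have [[b ->]|[c ->]] := surj n d.
    rewrite (_ : (fun q => _) = (fun q => u (real_pt b q.1, q.2))); last first.
      by apply/funext => q; rewrite wE phih.
    apply: (continuous_comp_fun cu); apply: continuous_pair; last exact: continuous_snd.
    exact: (continuous_comp_fun (@continuous_real_pt R B n b) (@continuous_fst _ _)).
  rewrite (_ : (fun q => _) = (fun q => v (real_pt c q.1, q.2))); last first.
    by apply/funext => q; rewrite wE phik.
  apply: (continuous_comp_fun cv); apply: continuous_pair; last exact: continuous_snd.
  exact: (continuous_comp_fun (@continuous_real_pt R C n c) (@continuous_fst _ _)).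
- by elim/real_ind: b => n b t; rewrite realization_mapE wE phih.
- by elim/real_ind: c => n c t; rewrite realization_mapE wE phik.
Qed.

(** Retract and deform on [|B|] as given, and stay put on [|C|]; the two agree on [|A|] because [r]
    and [H] are trivial there. *)
Lemma strong_retract_pushout :
  strong_retract R (@realization_map R _ _ f) ->
  strong_retract R (@realization_map R _ _ k).
Proof.
move=> [r [H [[cr cH] rf H0 H1 Hf]]]; have [comm _ _] := po.
have hf a : realization_map h (realization_map f a) =
    realization_map k (realization_map g a).
  by elim/real_ind: a => n a t; rewrite !realization_mapE comm.
have c1 (T : topologicalType) : continuous (@fst T R) by exact: continuous_fst.
have [|||w [cw wh wk]] := @real_pushout _ (fun q => realization_map g (r q.1)) fst.
- exact: continuous_realization_map (continuous_comp_fun cr (c1 _)).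
- exact: c1.
- by move=> a s /=; rewrite rf.
have [|||K [cK Kh Kk]] := @real_pushout _ (fun q => realization_map h (H q))
  (fun q => realization_map k q.1).
- exact: continuous_realization_map cH.
- exact: continuous_realization_map (c1 _).
- by move=> a s /=; rewrite Hf hf.
exists (fun d => w (d, 0)), K; split=> [|c|d|d|c s].
- split=> //; apply: (@continuous_comp_fun _ _ _ w (fun d => (d, 0)) cw).
  by apply: continuous_pair; [exact: continuous_id|exact: cst_continuous].
- by rewrite wk.
- have [[b ->]|[c ->]] := real_pushout_surj d; first by rewrite Kh H0.
  by rewrite Kk.
- have [[b ->]|[c ->]] := real_pushout_surj d; first by rewrite Kh H1 wh hf.
  by rewrite Kk wk.
- by rewrite Kk.
Qed.
End LevelwisePushout.

Lemma spush_levelwise_pushout (A B C : sset) (f : smap A B) (g : smap A C) :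
  levelwise_pushout f g (spush_inl f g) (spush_inr f g).
Proof.
split=> [n a|n|n U u v uv]; first exact: spush_glue.
- by apply: spush_ind => x; [left|right]; exists x.
- exists (po_elim (f := f) (g := g) u v); split=> x.
    exact: po_elim_inl.
  exact: po_elim_inr.
Qed.

Section ProductHomotopy.
Variable R : realType.

Lemma strong_retract_prod (Y Z W : sset) (f : smap Y Z) :
  strong_retract R (@realization_map R _ _ f) ->
  strong_retract R (@realization_map R _ _ (sprod_map f (sid W))).
Proof.
move=> [r [H [[cr cH] rf H0 H1 Hf]]].
have c0 (T : topologicalType) : continuous (fun x : T => (x, 0 : R)).
  by apply: continuous_pair; [exact: continuous_id|exact: cst_continuous].
have cr1 : continuous (fun q : realization R Z * R => r q.1).
  exact: (continuous_comp_fun cr (@continuous_fst _ _)).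
have c2 := rpair_continuous (W := W) (@locally_compactR R) (@Rhausdorff R) cr1.
have fstE z : realization_map (sfst Z W) (realization_map (sprod_map f (sid W)) z) =
    realization_map f (realization_map (sfst Y W) z) :> realization R Z.
  by elim/real_ind: z => n [y w] t; rewrite !realization_mapE.
have sndE z : realization_map (ssnd Z W) (realization_map (sprod_map f (sid W)) z) =
    realization_map (ssnd Y W) z :> realization R W.
  by elim/real_ind: z => n [y w] t; rewrite !realization_mapE.
exists (fun z => rpair (r (realization_map (sfst Z W) z)) (realization_map (ssnd Z W) z)).
exists (fun q => rpair (H (realization_map (sfst Z W) q.1, q.2))
  (realization_map (ssnd Z W) q.1)); split=> [|z|z|z|z s] /=.
- split; first exact: (continuous_comp_fun c2 (c0 _)).
  exact: rpair_continuous (@locally_compactR R) (@Rhausdorff R) cH.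
- by rewrite fstE sndE rf rpair_eta.
- by rewrite H0 rpair_eta.
- by rewrite H1 rpair_map realization_map_id.
- by rewrite fstE sndE Hf -[in RHS](rpair_eta z) rpair_map realization_map_id.
Qed.

Lemma sinjective_strong_retract (A B : sset) (i : smap A B) :
  sinjective i -> hequiv R (@realization_map R _ _ i) ->
  strong_retract R (@realization_map R _ _ i).
Proof.
move=> inj; apply: hequiv_strong_retract => T F h cF ch hF.
exact: (homotopy_extension_cells (@locally_compactR R) (@Rhausdorff R) inj cF ch hF).
Qed.


(** * Homotopies given by maps out of [X x Delta^1] *)

Program Definition sDelta (p : nat) : sset :=
  @SSet (fun n => dhom n p) (fun m n f g => dcomp g f) _ _.
Next Obligation. by move=> p n x; apply: dhom_ext => i; rewrite !mk_dhomE. Qed.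
Next Obligation. by move=> *; apply: dhom_ext => i; rewrite !mk_dhomE. Qed.

Definition svertex (p n : nat) (c : 'I_p.+1) : sDelta p n :=
  @mk_dhom n p (fun=> c) (fun _ _ _ => leqnn _).

Lemma svertex_act p m n (f : dhom m n) (c : 'I_p.+1) :
  act f (svertex n c) = svertex m c.
Proof. by apply: dhom_ext => i; rewrite !mk_dhomE. Qed.

Lemma edge_ge0 (s : R) (i : 'I_2) : 0 <= (if i == ord0 then 1 - clamp s else clamp s).
Proof. by case: eqP => _; rewrite ?subr_ge0 ?clamp_le1 ?clamp_ge0. Qed.

Lemma edge_sum (s : R) : \sum_(i < 2) (if i == ord0 then 1 - clamp s else clamp s) = 1.
Proof. by rewrite big_ord_recl big_ord1 /= subrK. Qed.

Definition edge (s : R) : std_simplex R 1 := mk_simplex (edge_ge0 s) (edge_sum s).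

Lemma edge_continuous : continuous edge.
Proof.
apply: continuous_simplex => i.
rewrite (_ : (fun x => _) = fun s => if i == ord0 then 1 - clamp s else clamp s).
  case: (i == ord0); last exact: clamp_continuous.
  apply: continuous_add; first exact: cst_continuous.
  exact/continuous_opp/clamp_continuous.
by apply/funext => s; rewrite mk_simplexE.
Qed.

Lemma simplex_map_svertex n p (c : 'I_p.+1) (t : std_simplex R n) j :
  bary (simplex_map (svertex n c) t) j = (c == j)%:R.
Proof.
rewrite bary_map (eq_bigl (fun=> c == j)) => [|i]; last by rewrite mk_dhomE.
by case: eqP => _; [exact: bary_sum|rewrite big_pred0].
Qed.

(** [rpair] against the nondegenerate edge is continuous, as the second coordinate stays in one
    cell; this gives [|X| x [0, 1] -> |X x Delta^1|]. *)
Lemma simplicial_homotopy (X X' : sset) (f0 f1 : smap X X')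
    (k : smap (sprod X (sDelta 1)) X') :
  (forall n x, k n (x, svertex n ord0) = f0 n x) ->
  (forall n x, k n (x, svertex n ord_max) = f1 n x) ->
  homot R (@realization_map R _ _ f0) (@realization_map R _ _ f1).
Proof.
move=> k0 k1.
pose I1 := did 1 : sDelta 1 1.
(* An endpoint of the edge is also the point with coordinates [t] of a constant [n]-simplex, the
   form that [rpairE] needs. *)
have end_pt n (t : std_simplex R n) c s :
    (forall j, bary (edge s) j = (c == j)%:R) ->
    real_pt I1 (edge s) = real_pt (svertex n c) t.
  move=> ec; rewrite (_ : edge s = simplex_map (svertex n c) t); last first.
    by apply: bary_inj => j; rewrite ec simplex_map_svertex.
  by rewrite -real_pt_act; congr real_pt; apply: dhom_ext => i; rewrite !mk_dhomE.
exists (fun q => realization_map k (rpair q.1 (real_pt I1 (edge q.2)))).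
split=> [|z|z] /=.
- apply: continuous_realization_map.
  apply: (@continuous_comp_fun _ _ _
    (fun q : realization R X * std_simplex R 1 => rpair q.1 (real_pt I1 q.2))
    (fun q => (q.1, edge q.2))); first exact: rpair_cell_continuous.
  apply: continuous_pair; first exact: continuous_fst.
  exact: (continuous_comp_fun edge_continuous (@continuous_snd _ _)).
- elim/real_ind: z => n x t; rewrite (end_pt n t ord0).
    by rewrite rpairE !realization_mapE k0.
  by move=> j; rewrite mk_simplexE clamp_le0 // subr0 eq_sym; case: eqP.
- elim/real_ind: z => n x t; rewrite (end_pt n t ord_max).
    by rewrite rpairE !realization_mapE k1.
  move=> j; rewrite mk_simplexE clamp_ge1 // subrr.
  case: eqP => [->//|/eqP j0].
  rewrite (_ : ord_max == j) //; apply/eqP/val_inj => /=.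
  have : (j : nat) != 0 by apply: contra j0 => /eqP e; apply/eqP/val_inj.
  by have := ltn_ord j; lia.
Qed.
End ProductHomotopy.

(** * Smash products and weak equivalences *)

Lemma dcomp_idl m n (f : dhom m n) : dcomp (did n) f = f.
Proof. by apply: dhom_ext => i; rewrite !mk_dhomE. Qed.

Lemma dcomp_idr m n (f : dhom m n) : dcomp f (did m) = f.
Proof. by apply: dhom_ext => i; rewrite !mk_dhomE. Qed.

Lemma dcompA m n p q (h : dhom p q) (g : dhom n p) (f : dhom m n) :
  dcomp h (dcomp g f) = dcomp (dcomp h g) f.
Proof. by apply: dhom_ext => i; rewrite !mk_dhomE. Qed.

(* A map into [cofree S] is just a family of functions into the [S k], so that it extends
   along every injection. *)
Program Definition cofree (S : nat -> Type) : sset :=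
  @SSet (fun n => forall k, dhom k n -> option (S k))
    (fun m n f e k g => e k (dcomp f g)) _ _.
Next Obligation.
move=> S n x; apply: functional_extensionality_dep => k; apply/funext => g.
by rewrite dcomp_idl.
Qed.
Next Obligation.
move=> S m n p g f x; apply: functional_extensionality_dep => k; apply/funext => h.
by rewrite dcompA.
Qed.

Program Definition to_cofree (X : sset) (S : nat -> Type)
    (c : forall k, X k -> option (S k)) : smap X (cofree S) :=
  @SMap X (cofree S) (fun n x k g => c k (act g x)) _.
Next Obligation.
move=> X S c m n f x; apply: functional_extensionality_dep => k; apply/funext => g.
by rewrite /= act_comp.
Qed.

Lemma eq_cofree (S : nat -> Type) n (e e' : cofree S n) :
  (forall k (g : dhom k n), e k g = e' k g) -> e = e'.
Proof.
by move=> ee'; apply: functional_extensionality_dep => k; apply/funext => g.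
Qed.

Program Definition spair (A B C : sset) (f : smap A B) (g : smap A C) :
    smap A (sprod B C) := @SMap A (sprod B C) (fun n x => (f n x, g n x)) _.
Next Obligation. by move=> A B C f g m n h x; congr (_, _); exact: sfun_act. Qed.

(** * Factorization of a morphism through a product with a cofree simplicial set *)

Section Factorization.
Variables (X : sset) (Y Z : retractive X) (f : rmap Y Z).

Let unitY : smap Y (cofree Y) := to_cofree (fun k => @Some (Y k)).

(** The map [X -> cofree Y] is extended along the section of [Z], with [None] off its image; this is
    the purpose of [option] in [cofree]. *)
Let unitX_ext : smap Z (cofree Y) := to_cofree (fun k z =>
  if pselect (z = sect Z k (retr Z k z)) then Some (sect Y k (retr Z k z)) else None).

Let unitX_extE n (x : X n) : unitX_ext n (sect Z n x) = unitY n (sect Y n x).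
Proof.
by apply: eq_cofree => k g /=; rewrite -!sfun_act sectK; case: pselect.
Qed.

Program Definition cylinder : retractive X :=
  @Retractive X (sprod Z (cofree Y)) (scomp (retr Z) (sfst Z (cofree Y)))
    (spair (sect Z) (scomp unitY (sect Y))) _.
Next Obligation. by move=> n x; rewrite /= sectK. Qed.

Program Definition cylinder_in : rmap Y cylinder :=
  @RMap X Y cylinder (spair f unitY) _ _.
Next Obligation. by move=> n y; rewrite /= rfun_retr. Qed.
Next Obligation. by move=> n y; rewrite /= rfun_sect. Qed.

Program Definition cylinder_out : rmap cylinder Z :=
  @RMap X cylinder Z (sfst Z (cofree Y)) _ _.
Next Obligation. by []. Qed.
Next Obligation. by []. Qed.

Program Definition cylinder_section : rmap Z cylinder :=
  @RMap X Z cylinder (spair (sid Z) unitX_ext) _ _.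
Next Obligation. by []. Qed.
Next Obligation. by move=> n x; congr (_, _); exact: unitX_extE. Qed.

Lemma cylinder_in_inj : sinjective cylinder_in.
Proof.
move=> n y y' [_ /(congr1 (fun e : cofree Y n => e n (did n)))] /=.
by rewrite !act_id => -[].
Qed.

Lemma cylinder_section_inj : sinjective cylinder_section.
Proof. by move=> n z z' []. Qed.

Lemma cylinder_inK : rcomp cylinder_out cylinder_in = f.
Proof. exact: rmap_ext. Qed.

Lemma cylinder_sectionK : rcomp cylinder_out cylinder_section = rid Z.
Proof. exact: rmap_ext. Qed.

(** Maps into [cofree Y] are subject to no compatibility, so the homotopy may jump: it keeps the
    given element over the initial vertex and takes the value of [unitX_ext] over all other
    simplices of [Delta^1]. *)
Let contraction : smap (sprod (sprod Z (cofree Y)) (sDelta 1)) (cofree Y) :=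
  to_cofree (fun k (q : sprod (sprod Z (cofree Y)) (sDelta 1) k) =>
    if pselect (q.2 = svertex k ord0) then q.1.2 k (did k)
    else unitX_ext k q.1.1 k (did k)).

Definition cylinder_contraction :
    smap (sprod (sprod Z (cofree Y)) (sDelta 1)) (sprod Z (cofree Y)) :=
  spair (scomp (sfst Z (cofree Y)) (sfst (sprod Z (cofree Y)) (sDelta 1))) contraction.

Lemma cylinder_out_hequiv (R : realType) : hequiv R (@realization_map R _ _ cylinder_out).
Proof.
split; first exact: realization_map_continuous.
exists (realization_map cylinder_section); split.
- exact: realization_map_continuous.
- rewrite -realization_map_comp -realization_map_id; apply: homot_sym.
  apply: (@simplicial_homotopy R _ _ _ _ cylinder_contraction) => n [z e].
    congr (_, _); apply: eq_cofree => k g /=.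
    rewrite (_ : dcomp _ g = svertex k ord0); last exact: svertex_act.
    by case: pselect => [?|[]] //=; rewrite dcomp_idr.
  congr (_, _); apply: eq_cofree => k g /=.
  rewrite (_ : dcomp _ g = svertex k ord_max); last exact: svertex_act.
  case: pselect => [e01|? /=]; last by rewrite act_id.
  by have := congr1 (fun d : dhom k 1 => val (d ord0)) e01; rewrite !mk_dhomE.
- rewrite -realization_map_comp.
  rewrite (_ : scomp _ _ = sid Z); last exact: smap_ext.
  by rewrite realization_map_id; exact/homot_refl/continuous_id.
Qed.
End Factorization.

(** * Smashing with a fixed object preserves weak equivalences *)

Section SmashEquivalence.
Variables (R : realType) (X1 X2 : sset).
Notation hequiv_s f := (hequiv R (@realization_map R _ _ f)).

Section Injective.
Variables (Y Z : retractive X1) (f : rmap Y Z) (W : retractive X2).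

Let corner : sset := spush (sprod_map f (sid X2)) (sprod_map (sid Y) (sect W)).

Program Definition corner_prod : smap corner (sprod Z W) :=
  @spush_lift _ _ _ _ _ (sprod Z W) (sprod_map (sid Z) (sect W)) (sprod_map f (sid W)) _.
Next Obligation. by []. Qed.

Program Definition corner_smash : smap corner (smash Y W) :=
  @spush_lift _ _ _ _ _ (smash Y W)
    (scomp (sect (smash Y W)) (sprod_map (retr Z) (sid X2)))
    (spush_inl (fat_wedge_incl Y W) (fat_wedge_retr Y W)) _.
Next Obligation.
by move=> n [y x] /=; rewrite rfun_retr; apply/esym; exact: smash_sectr.
Qed.

(** The fat wedge of [Z] and [W] lies in the corner, because the section of [Z] is that of [Y]
    followed by [f]. Hence functions that agree on the corner are also compatible on the fat
    wedge. *)
Lemma smash_levelwise_pushout :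
  levelwise_pushout corner_prod corner_smash
    (spush_inl (fat_wedge_incl Z W) (fat_wedge_retr Z W)) (smash_map f (rid W)).
Proof.
split.
- move=> n; apply: spush_ind => [[z x]|[y w]].
    rewrite !spush_lift_inl -[LHS]/(smash_pair z (sect W n x)) smash_sectr.
    by apply/esym; exact: smash_smap_sect.
  rewrite !spush_lift_inr; apply/esym; exact: smash_smap_pair.
- move=> n; apply: smash_ind => [z w|x]; first by left; exists (z, w).
  by right; exists (sect (smash Y W) n x); apply/esym; exact: smash_smap_sect.
- move=> n U u v uv.
  have uv1 z x : u (z, sect W n x) = v (sect (smash Y W) n (retr Z n z, x)).
    have := uv (spush_inl (sprod_map f (sid X2)) (sprod_map (sid Y) (sect W)) n (z, x)).
    by rewrite !spush_lift_inl.
  have uv2 y w : u (f n y, w) = v (smash_pair y w).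
    have := uv (spush_inr (sprod_map f (sid X2)) (sprod_map (sid Y) (sect W)) n (y, w)).
    by rewrite !spush_lift_inr.
  pose w : smash Z W n -> U := po_elim (f := fat_wedge_incl Z W)
    (g := fat_wedge_retr Z W) u (fun x => v (sect (smash Y W) n x)).
  have glue : forall a, u (fat_wedge_incl Z W n a) =
      v (sect (smash Y W) n (fat_wedge_retr Z W n a)).
    apply: fat_wedge_ind => [z x|x y].
      by rewrite !spush_lift_inl uv1.
    rewrite !spush_lift_inr /=.
    by rewrite -(rfun_sect f) uv2 smash_sectl.
  have w_pair z y : w (smash_pair z y) = u (z, y) by exact: po_elim_inl.
  have w_sect x : w (sect (smash Z W) n x) = v (sect (smash Y W) n x).
    exact: po_elim_inr.
  exists w; split=> [[z y]|]; first exact: w_pair.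
  apply: smash_ind => [y z|x].
    by rewrite [smash_map _ _ _ _]smash_smap_pair w_pair uv2.
  by rewrite [smash_map _ _ _ _]smash_smap_sect w_sect.
Qed.

Hypothesis f_inj : sinjective f.

Lemma corner_prod_inj : sinjective corner_prod.
Proof.
have s_inj n : injective (sect W n).
  by move=> x x' /(congr1 (retr W n)); rewrite !sectK.
move=> n; apply: spush_ind => [[z x]|[y w]]; apply: spush_ind => [[z' x']|[y' w']];
  rewrite !(spush_lift_inl, spush_lift_inr) /= => -[].
- by move=> -> /s_inj ->.
- move=> -> <-; exact: (spush_glue (sprod_map f (sid X2)) (sprod_map (sid Y) (sect W)) (y', x)).
- move=> <- ->; apply/esym.
  exact: (spush_glue (sprod_map f (sid X2)) (sprod_map (sid Y) (sect W)) (y, x')).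
- by move=> /f_inj -> ->.
Qed.

Lemma smash_hequiv_inj : hequiv_s f -> hequiv_s (smash_map f (rid W)).
Proof.
move=> hf; have sf := sinjective_strong_retract f_inj hf.
have cm A B (g : smap A B) : continuous (realization_map g : realization R A -> _).
  exact: realization_map_continuous.
apply: strong_retract_hequiv; first exact: cm.
apply: strong_retract_pushout smash_levelwise_pushout _.
apply: (sinjective_strong_retract corner_prod_inj).
pose inr := spush_inr (sprod_map f (sid X2)) (sprod_map (sid Y) (sect W)).
(* Two out of three along [Y x W -> corner -> Z x W]: the first map is a pushout of [f x X2], the
   composite is [f x W]. *)
apply: (@hequiv_cancel_right R _ _ _ (realization_map inr)); first exact: cm.
  apply: strong_retract_hequiv; first exact: cm.
  apply: strong_retract_pushout (spush_levelwise_pushout _ _) _.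
  exact: strong_retract_prod.
rewrite -realization_map_comp.
rewrite (_ : scomp _ _ = sprod_map f (sid W)); last first.
  by apply: smap_ext => n q; exact: spush_lift_inr.
apply: strong_retract_hequiv; first exact: cm.
exact: strong_retract_prod.
Qed.
End Injective.

(* Ken Brown's argument. *)
Lemma smash_hequiv (Y Z : retractive X1) (f : rmap Y Z) (W : retractive X2) :
  hequiv_s f -> hequiv_s (smash_map f (rid W)).
Proof.
move=> hf; pose j := cylinder_in f; pose p := cylinder_out Y Z.
pose q := cylinder_section Y Z.
have cm A B (g : smap A B) : continuous (realization_map g : realization R A -> _).
  exact: realization_map_continuous.
have hp : hequiv_s p by exact: cylinder_out_hequiv.
have comp_real (A B C : retractive X1) (g : rmap B C) (k : rmap A B) :
    realization_map g \o realization_map k = realization_map (rcomp g k) :>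
    (realization R A -> realization R C) by rewrite -realization_map_comp.
have comp_smash (A B C : retractive X1) (g : rmap B C) (k : rmap A B) :
    realization_map (smash_map g (rid W)) \o realization_map (smash_map k (rid W)) =
    realization_map (smash_map (rcomp g k) (rid W)) :>
    (realization R (smash A W) -> realization R (smash C W)).
  rewrite -realization_map_comp; congr (@realization_map R _ _ _).
  rewrite (_ : rid W = rcomp (rid W) (rid W)); last exact: rmap_ext.
  by rewrite smash_map_comp (_ : rcomp (rid W) (rid W) = rid W) //; exact: rmap_ext.
have hid (A : sset) : hequiv_s (sid A).
  rewrite realization_map_id; apply: strong_retract_hequiv; first exact: continuous_id.
  by exists id, fst; split=> //; split; [exact: continuous_id|exact: continuous_fst].
have hj : hequiv_s j.
  apply: (@hequiv_cancel_left R _ _ _ _ (realization_map p)) => //; first exact: cm.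
  by have := hf; rewrite -{1}(cylinder_inK f) -comp_real.
have hq : hequiv_s q.
  apply: (@hequiv_cancel_left R _ _ _ _ (realization_map p)) => //; first exact: cm.
  by have := hid Z; rewrite -[sid Z]/(rfun (rid Z)) -(cylinder_sectionK Y) -comp_real.
have hqW := smash_hequiv_inj W (@cylinder_section_inj _ Y Z) hq.
have hjW := smash_hequiv_inj W (@cylinder_in_inj _ _ _ f) hj.
rewrite -(cylinder_inK f) -comp_smash; apply: hequiv_comp hjW _.
(* The map [p] need not be injective, but its section [q] is; the smash product of [p] is an
   equivalence as a left inverse of that of [q]. *)
apply: hequiv_cancel_right hqW _; first exact: cm.
have := hid (smash Z W); rewrite -[sid _]/(rfun (rid (smash Z W))) -smash_map_id.
by rewrite -(cylinder_sectionK Y) -comp_smash.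
Qed.
End SmashEquivalence.

(** * Smash products, cofibrations and pushouts *)

Section Swap.
Variables (X1 X2 : sset).

Definition sswap (A B : sset) : smap (sprod A B) (sprod B A) :=
  spair (ssnd A B) (sfst A B).

(** It lies over the swap of [X1 x X2], hence is a map of simplicial sets and not a morphism over a
    fixed base. It reduces the second variable to the first. *)
Program Definition smash_swap (Y : retractive X1) (W : retractive X2) :
    smap (smash Y W) (smash W Y) :=
  @spush_lift _ _ _ _ _ (smash W Y)
    (scomp (spush_inl (fat_wedge_incl W Y) (fat_wedge_retr W Y)) (sswap Y W))
    (scomp (sect (smash W Y)) (sswap X1 X2)) _.
Next Obligation.
move=> Y W n; apply: fat_wedge_ind => [y x|x y].
  by rewrite !spush_lift_inl; exact: smash_sectl.
by rewrite !spush_lift_inr; exact: smash_sectr.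
Qed.

Lemma smash_swap_pair (Y : retractive X1) (W : retractive X2) n (y : Y n) (w : W n) :
  smash_swap Y W n (smash_pair y w) = smash_pair w y.
Proof. exact: spush_lift_inl. Qed.

Lemma smash_swap_sect (Y : retractive X1) (W : retractive X2) n (x : sprod X1 X2 n) :
  smash_swap Y W n (sect (smash Y W) n x) = sect (smash W Y) n (x.2, x.1).
Proof. exact: spush_lift_inr. Qed.
End Swap.

Lemma smash_swapK (X1 X2 : sset) (Y : retractive X1) (W : retractive X2) n (z : smash Y W n) :
  smash_swap W Y n (smash_swap Y W n z) = z.
Proof.
elim/smash_ind: z => [y w|[x1 x2]]; first by rewrite !smash_swap_pair.
by rewrite !smash_swap_sect.
Qed.

Section SmashRight.
Variables (X1 X2 : sset).

Lemma smash_swap_map (Y Z : retractive X1) (f : rmap Y Z) (W : retractive X2) n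
    (z : smash W Y n) :
  smash_swap W Z n (smash_map (rid W) f n z) =
  smash_map f (rid W) n (smash_swap W Y n z).
Proof.
elim/smash_ind: z => [w y|x].
  rewrite [smash_map (rid W) f n _]smash_smap_pair !smash_swap_pair.
  by rewrite [RHS]smash_smap_pair.
rewrite [smash_map (rid W) f n _]smash_smap_sect !smash_swap_sect.
by rewrite [RHS]smash_smap_sect.
Qed.

Lemma smash_hequiv_right (R : realType) (Y Z : retractive X1) (f : rmap Y Z)
    (W : retractive X2) :
  hequiv R (@realization_map R _ _ f) ->
  hequiv R (@realization_map R _ _ (smash_map (rid W) f)).
Proof.
move=> /(smash_hequiv W) hf.
have hs (V1 V2 : sset) (A : retractive V1) (B : retractive V2) :
    hequiv R (@realization_map R _ _ (smash_swap A B)).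
  have sK (U1 U2 : sset) (C : retractive U1) (D : retractive U2) :
      homot R (realization_map (smash_swap D C) \o realization_map (smash_swap C D))
        (id : realization R (smash C D) -> _).
    rewrite -realization_map_comp (_ : scomp _ _ = sid _); last first.
      by apply: smap_ext => n z; exact: smash_swapK.
    by rewrite realization_map_id; exact/homot_refl/continuous_id.
  split; first exact: realization_map_continuous.
  exists (realization_map (smash_swap B A)).
  by split; [exact: realization_map_continuous|exact: sK|exact: sK].
have := hequiv_comp (hequiv_comp (hs _ _ W Y) hf) (hs _ _ Z W).
rewrite -!realization_map_comp; congr (hequiv R (@realization_map R _ _ _)).
apply: smap_ext => n z.
exact: etrans (congr1 (smash_swap Z W n) (esym (smash_swap_map f z))) (smash_swapK _).
Qed.

Lemma smash_pushout_left (A B C D : retractive X1) (f : rmap A B) (g : rmap A C)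
    (h : rmap B D) (k : rmap C D) (W : retractive X2) :
  levelwise_pushout f g h k ->
  levelwise_pushout (smash_map f (rid W)) (smash_map g (rid W))
    (smash_map h (rid W)) (smash_map k (rid W)).
Proof.
have mapE (Y Z : retractive X1) (e : rmap Y Z) n (y : Y n) (w : W n) :
    smash_map e (rid W) n (smash_pair y w) = smash_pair (e n y) w.
  exact: smash_smap_pair.
have mapS (Y Z : retractive X1) (e : rmap Y Z) n x :
    smash_map e (rid W) n (sect (smash Y W) n x) = sect (smash Z W) n x.
  exact: smash_smap_sect.
move=> [comm surj elim_po]; split.
- move=> n; apply: smash_ind => [a w|x]; last by rewrite !mapS.
  by rewrite !mapE comm.
- move=> n; apply: smash_ind => [d w|x]; last first.
    by left; exists (sect (smash B W) n x); rewrite mapS.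
  have [[b ->]|[c ->]] := surj n d; [left|right].
    by exists (smash_pair b w); rewrite mapE.
  by exists (smash_pair c w); rewrite mapE.
- move=> n U u v uv.
  have vs x : u (sect (smash B W) n x) = v (sect (smash C W) n x).
    by have := uv (sect (smash A W) n x); rewrite !mapS.
  have ex (w : W n) : exists e : D n -> U,
      (forall b, e (h n b) = u (smash_pair b w)) /\
      (forall c, e (k n c) = v (smash_pair c w)).
    by apply: elim_po => a; have := uv (smash_pair a w); rewrite !mapE.
  pose e (q : sprod D W n) : U := projT1 (cid (ex q.2)) q.1.
  have eh b w : e (h n b, w) = u (smash_pair b w).
    by rewrite /e /=; case: cid => e' [].
  have ek c w : e (k n c, w) = v (smash_pair c w).
    by rewrite /e /=; case: cid => e' [].
  have glue : forall q, e (fat_wedge_incl D W n q) =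
      u (sect (smash B W) n (fat_wedge_retr D W n q)).
    apply: fat_wedge_ind => [d x|x w]; rewrite !(spush_lift_inl, spush_lift_inr) /=.
      have [[b ->]|[c ->]] := surj n d.
        by rewrite eh smash_sectr rfun_retr.
      by rewrite ek smash_sectr rfun_retr vs.
    by rewrite -(rfun_sect h) eh smash_sectl.
  pose E : smash D W n -> U := po_elim (f := fat_wedge_incl D W)
    (g := fat_wedge_retr D W) e (fun x => u (sect (smash B W) n x)).
  have E_pair d w : E (smash_pair d w) = e (d, w) by exact: po_elim_inl.
  have E_sect x : E (sect (smash D W) n x) = u (sect (smash B W) n x).
    exact: po_elim_inr.
  exists E; split; apply: smash_ind => [y w|x]; rewrite ?mapE ?mapS.
  + by rewrite E_pair eh.
  + exact: E_sect.
  + by rewrite E_pair ek.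
  + by rewrite E_sect vs.
Qed.
End SmashRight.

Lemma smash_pushout_right (X1 X2 : sset) (A B C D : retractive X1) (f : rmap A B)
    (g : rmap A C) (h : rmap B D) (k : rmap C D) (W : retractive X2) :
  levelwise_pushout f g h k ->
  levelwise_pushout (smash_map (rid W) f) (smash_map (rid W) g)
    (smash_map (rid W) h) (smash_map (rid W) k).
Proof.
move=> /(smash_pushout_left W)[comm surj elim_po].
have mapE (Y Z : retractive X1) (e : rmap Y Z) n (z : smash Y W n) :
    smash_map (rid W) e n (smash_swap Y W n z) =
    smash_swap Z W n (smash_map e (rid W) n z).
  by rewrite -[LHS]smash_swapK smash_swap_map smash_swapK.
split.
- by move=> n a; rewrite -[a]smash_swapK !mapE comm.
- move=> n d; rewrite -[d]smash_swapK.
  have [[b ->]|[c ->]] := surj n (smash_swap W D n d); [left|right].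
    by exists (smash_swap B W n b); rewrite mapE.
  by exists (smash_swap C W n c); rewrite mapE.
- move=> n U u v uv.
  have [|w [wh wk]] := elim_po n U (fun z => u (smash_swap B W n z))
    (fun z => v (smash_swap C W n z)).
    by move=> a; rewrite -!mapE uv.
  exists (fun z => w (smash_swap W D n z)); split=> z.
    by rewrite smash_swap_map wh smash_swapK.
  by rewrite smash_swap_map wk smash_swapK.
Qed.

(** * Normal forms of simplices in a smash product, and injectivity *)

Section SmashInjective.
Variables X1 X2 : sset.

Section NormalForm.
Variables (Y1 : retractive X1) (Y2 : retractive X2) (n : nat).

Definition in_section (q : Y1 n * Y2 n) : Prop :=
  (exists x, sect Y1 n x = q.1) \/ (exists x, sect Y2 n x = q.2).

(** In each degree [Y1 ^ Y2] is the disjoint union of [X1 x X2] and of the pairs with neither entry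
    in a section; this makes equality in the quotient explicit. *)
Definition smash_nf : smash Y1 Y2 n -> (Y1 n * Y2 n) + (X1 n * X2 n) :=
  po_elim (f := fat_wedge_incl Y1 Y2) (g := fat_wedge_retr Y1 Y2)
    (fun q : sprod Y1 Y2 n => if pselect (in_section q) then
       inr (retr Y1 n q.1, retr Y2 n q.2) else inl q) inr.

Lemma smash_nf_glue a :
  (if pselect (in_section (fat_wedge_incl Y1 Y2 n a)) then
     inr (retr Y1 n (fat_wedge_incl Y1 Y2 n a).1, retr Y2 n (fat_wedge_incl Y1 Y2 n a).2)
   else inl (fat_wedge_incl Y1 Y2 n a)) =
  inr (fat_wedge_retr Y1 Y2 n a) :> (Y1 n * Y2 n) + (X1 n * X2 n).
Proof.
elim/fat_wedge_ind: a => [y x|x y];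
  rewrite !(spush_lift_inl, spush_lift_inr) /= sectK; case: pselect => // -[].
  by right; exists x.
by left; exists x.
Qed.

Lemma smash_nf_pair (y1 : Y1 n) (y2 : Y2 n) : smash_nf (smash_pair y1 y2) =
  if pselect (in_section (y1, y2)) then inr (retr Y1 n y1, retr Y2 n y2)
  else inl (y1, y2).
Proof. exact: (po_elim_inl smash_nf_glue). Qed.

Lemma smash_nf_sect x : smash_nf (sect (smash Y1 Y2) n x) = inr x.
Proof. exact: (po_elim_inr smash_nf_glue). Qed.

Lemma smash_nf_inj : injective smash_nf.
Proof.
pose back (s : (Y1 n * Y2 n) + (X1 n * X2 n)) : smash Y1 Y2 n :=
  match s with inl q => smash_pair q.1 q.2 | inr x => sect (smash Y1 Y2) n x end.
apply: (can_inj (g := back)); apply: smash_ind => [y1 y2|x]; last by rewrite smash_nf_sect.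
rewrite smash_nf_pair; case: pselect => //= -[] [x /= <-].
  by rewrite smash_sectl sectK.
by rewrite smash_sectr sectK.
Qed.
End NormalForm.

(** An injective morphism over [X] reflects membership in the section, so [smash_map] acts on normal
    forms summand by summand. *)
Lemma smash_map_inj (Y1 Z1 : retractive X1) (Y2 Z2 : retractive X2)
    (f1 : rmap Y1 Z1) (f2 : rmap Y2 Z2) :
  sinjective f1 -> sinjective f2 -> sinjective (smash_map f1 f2).
Proof.
move=> inj1 inj2 n.
have section_map q : in_section (f1 n q.1, f2 n q.2) <-> in_section q.
  split=> -[] [x /= ex].
  - by left; exists x; apply: inj1; rewrite rfun_sect.
  - by right; exists x; apply: inj2; rewrite rfun_sect.
  - by left; exists x; rewrite -ex rfun_sect.
  - by right; exists x; rewrite -ex rfun_sect.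
pose nf_map (s : (Y1 n * Y2 n) + (X1 n * X2 n)) : (Z1 n * Z2 n) + (X1 n * X2 n) :=
  match s with inl q => inl (f1 n q.1, f2 n q.2) | inr x => inr x end.
have nf_map_inj : injective nf_map.
  by move=> [[a b]|x] [[a' b']|x'] //= [] => [/inj1 -> /inj2 ->|->].
have nfE z : smash_nf (smash_map f1 f2 n z) = nf_map (smash_nf z).
  elim/smash_ind: z => [y1 y2|x]; last first.
    by rewrite [smash_map _ _ _ _]smash_smap_sect !smash_nf_sect.
  rewrite [smash_map _ _ _ _]smash_smap_pair !smash_nf_pair.
  have [to from] := section_map (y1, y2).
  case: pselect => [s|ns]; case: pselect => [s'|ns'] //=.
  - by rewrite !rfun_retr.
  - by case: ns'; exact: to.
  - by case: ns; exact: from.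
by move=> z z' /(congr1 (@smash_nf _ _ _)); rewrite !nfE => /nf_map_inj /smash_nf_inj.
Qed.
End SmashInjective.

(** * Pushouts in [R_f(X)] are levelwise pushouts *)

Section Pushouts.
Variable X : sset.

Section RetractivePushout.
Variables (A B C : retractive X) (f : rmap A B) (g : rmap A C).

Program Definition retractive_pushout : retractive X :=
  @Retractive X (spush f g) (@spush_lift _ _ _ f g X (retr B) (retr C) _)
    (scomp (spush_inl f g) (sect B)) _.
Next Obligation. by move=> n a; rewrite !rfun_retr. Qed.
Next Obligation. by move=> n x; rewrite [LHS]spush_lift_inl sectK. Qed.

Program Definition retractive_inl : rmap B retractive_pushout :=
  @RMap X B retractive_pushout (spush_inl f g) _ _.
Next Obligation. by move=> n b; exact: spush_lift_inl. Qed.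
Next Obligation. by []. Qed.

Program Definition retractive_inr : rmap C retractive_pushout :=
  @RMap X C retractive_pushout (spush_inr f g) _ _.
Next Obligation. by move=> n b; exact: spush_lift_inr. Qed.
Next Obligation.
move=> n x; have := spush_glue f g (sect A n x).
by rewrite !rfun_sect => <-.
Qed.

Lemma degenerate_map (Y Z : sset) (h : smap Y Z) n (y : Y n) :
  degenerate y -> degenerate (h n y).
Proof. by case=> m i z; rewrite sfun_act; exact: Degenerate. Qed.

(** The universal property in [R_f(X)] speaks only of finite objects, so the levelwise pushout has
    to be one of them before it can serve as a target. *)
Lemma retractive_pushout_finite :
  finite_retractive B -> finite_retractive C -> finite_retractive retractive_pushout.
Proof.
move=> finB finC.
pose inl' (b : {n & B n}) : {n & retractive_pushout n} :=
  existT (fun n => retractive_pushout n) (projT1 b) (retractive_inl _ (projT2 b)).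
pose inr' (c : {n & C n}) : {n & retractive_pushout n} :=
  existT (fun n => retractive_pushout n) (projT1 c) (retractive_inr _ (projT2 c)).
apply: (@sub_finite_set _ _ (inl' @` new_simplices B `|` inr' @` new_simplices C)).
  move=> [n d] [/= nd ns]; elim/(@spush_ind _ _ _ f g n): d nd ns => [b|c] nd ns.
    left; exists (existT _ n b) => //; split=> /= [db|[x ex]].
      by apply: nd; exact: (degenerate_map (spush_inl f g)).
    by apply: ns; exists x; rewrite -ex; exact/esym/(rfun_sect retractive_inl).
  right; exists (existT _ n c) => //; split=> /= [dc|[x ex]].
    by apply: nd; exact: (degenerate_map (spush_inr f g)).
  by apply: ns; exists x; rewrite -ex; exact/esym/(rfun_sect retractive_inr).
by rewrite finite_setU; split; exact: finite_image.
Qed.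
End RetractivePushout.

(** The pushout [D] is a retract of the levelwise pushout: [l w = id] by uniqueness. Joint
    surjectivity comes through [l], and functions on the levelwise pushout are restricted along
    [w]. *)
Lemma pushout_levelwise (A B C D : Rf_cat X) (f : hom A B) (g : hom A C) (h : hom B D)
    (k : hom C D) :
  is_pushout f g h k ->
  @levelwise_pushout (sval A) (sval B) (sval C) (sval D)
    (f : rmap _ _) (g : rmap _ _) (h : rmap _ _) (k : rmap _ _).
Proof.
move=> [comm univ].
pose P : Rf_cat X := exist _ (retractive_pushout f g)
  (retractive_pushout_finite f g (svalP B) (svalP C)).
have commE n a : (h : rmap _ _) n ((f : rmap _ _) n a) =
    (k : rmap _ _) n ((g : rmap _ _) n a).
  by have := congr1 (fun e : rmap (sval A) (sval D) => e n a) comm.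
have [|w [[wh wk] _]] := univ P (retractive_inl f g) (retractive_inr f g).
  by apply: rmap_ext => n a; exact: spush_glue.
have whE n b : (w : rmap _ _) n ((h : rmap _ _) n b) = spush_inl f g n b.
  by have := congr1 (fun e : rmap (sval B) (sval P) => e n b) wh.
have wkE n c : (w : rmap _ _) n ((k : rmap _ _) n c) = spush_inr f g n c.
  by have := congr1 (fun e : rmap (sval C) (sval P) => e n c) wk.
pose l0 := @spush_lift _ _ _ f g _ (h : rmap _ _) (k : rmap _ _) commE.
have l0_retr n (p : retractive_pushout f g n) :
    retr (sval D) n (l0 n p) = retr (retractive_pushout f g) n p.
  elim/(@spush_ind _ _ _ f g n): p => x.
    by rewrite /l0 spush_lift_inl rfun_retr; apply/esym; exact: spush_lift_inl.
  by rewrite /l0 spush_lift_inr rfun_retr; apply/esym; exact: spush_lift_inr.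
have l0_sect n x : l0 n (sect (retractive_pushout f g) n x) = sect (sval D) n x.
  by rewrite [LHS]spush_lift_inl rfun_sect.
pose l : rmap (retractive_pushout f g) (sval D) := RMap l0_retr l0_sect.
have lw n d : l n ((w : rmap _ _) n d) = d.
  have [e [_ uniq]] := univ D h k comm.
  have e1 : e = rcomp l w.
    apply: uniq; split; apply: rmap_ext => m x /=.
      by rewrite whE; exact: spush_lift_inl.
    by rewrite wkE; exact: spush_lift_inr.
  have e2 : e = rid (sval D) by apply: uniq; split; exact: rmap_ext.
  have := congr1 (fun r : rmap (sval D) (sval D) => r n d) (etrans (esym e1) e2).
  by [].
split=> //.
- move=> n d; rewrite -(lw n d).
  elim/(@spush_ind _ _ _ f g n): ((w : rmap _ _) n d) => x; [left|right]; exists x.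
    exact: spush_lift_inl.
  exact: spush_lift_inr.
- move=> n U u v uv.
  exists (fun d => po_elim (f := f : rmap _ _) (g := g : rmap _ _) u v
    ((w : rmap _ _) n d)); split=> x.
    by rewrite whE; exact: po_elim_inl.
  by rewrite wkE; exact: po_elim_inr.
Qed.

Lemma levelwise_is_pushout (A B C D : Rf_cat X) (f : hom A B) (g : hom A C) (h : hom B D)
    (k : hom C D) :
  @levelwise_pushout (sval A) (sval B) (sval C) (sval D)
    (f : rmap _ _) (g : rmap _ _) (h : rmap _ _) (k : rmap _ _) ->
  is_pushout f g h k.
Proof.
move=> [comm surj elim_po]; split; first by apply: rmap_ext => n a; exact: comm.
move=> T u v uv.
have ex n : exists w : sval D n -> sval T n,
    (forall b, w ((h : rmap _ _) n b) = (u : rmap _ _) n b) /\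
    (forall c, w ((k : rmap _ _) n c) = (v : rmap _ _) n c).
  apply: elim_po => a.
  by have := congr1 (fun e : rmap (sval A) (sval T) => e n a) uv.
pose w n := projT1 (cid (ex n)).
have wh n b : w n ((h : rmap _ _) n b) = (u : rmap _ _) n b.
  by rewrite /w; case: cid => e [].
have wk n c : w n ((k : rmap _ _) n c) = (v : rmap _ _) n c.
  by rewrite /w; case: cid => e [].
(* The functions [w n] are chosen degree by degree; joint surjectivity of [h] and [k] makes them
   simplicial. *)
have w_act m n (e : dhom m n) d : w m (act e d) = act e (w n d).
  have [[b ->]|[c ->]] := surj n d.
    by rewrite -sfun_act !wh sfun_act.
  by rewrite -sfun_act !wk sfun_act.
pose ws : smap (sval D) (sval T) := SMap w_act.
have w_retr n d : retr (sval T) n (ws n d) = retr (sval D) n d.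
  have [[b ->]|[c ->]] := surj n d; rewrite /= ?wh ?wk !rfun_retr //.
have w_sect n x : ws n (sect (sval D) n x) = sect (sval T) n x.
  by rewrite -(rfun_sect (h : rmap _ _)) /= wh rfun_sect.
exists (RMap w_retr w_sect : rmap (sval D) (sval T)); split.
  by split; apply: rmap_ext => n x; [exact: wh|exact: wk].
move=> e [eh ek]; apply: rmap_ext => n d.
have [[b ->]|[c ->]] := surj n d; rewrite /= ?wh ?wk.
  by have := congr1 (fun r : rmap (sval B) (sval T) => r n b) eh => /= ->.
by have := congr1 (fun r : rmap (sval C) (sval T) => r n c) ek => /= ->.
Qed.
End Pushouts.

Theorem proposition2p9 (R : realType) (X1 X2 : sset) :
  @biexact (Rf R X1) (Rf R X2) (Rf R (sprod X1 X2)) (ext_smash X1 X2).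
Proof.
split=> W; split=> [A B f inj|A B C D f g h k _ po|A B f /hequivP hf].
- by apply: (@smash_map_inj _ _ _ _ _ _ _ _) => // n x x'.
- exact/levelwise_is_pushout/smash_pushout_left/pushout_levelwise.
- exact/hequivP/smash_hequiv.
- by apply: (@smash_map_inj _ _ _ _ _ _ _ _) => // n x x'.
- exact/levelwise_is_pushout/smash_pushout_right/pushout_levelwise.
- exact/hequivP/smash_hequiv_right.
Qed.
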